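(* Let $\beta=(\beta_n)_{n\ge0}$ be a sequence of positive numbers with polynomial decay and polynomial growth. Assume that $\beta$ is weakly decreasing, i.e. for every $\delta>0$ there exists a positive constant $C=C(\delta)$ such that $$\beta_m\le C\,\beta_n\quad\text{whenever } m>(1+\delta)\,n .$$ Then, for all symbols $\varphi:\mathbb{D}\to\mathbb{D}$ vanishing at $0$, the composition operator $C_\varphi$ is bounded on $H^2(\beta)$.
   Context: $\mathbb{D}$ is the open unit disk of $\mathbb{C}$. A sequence $\beta=(\beta_n)_{n\ge0}$ of positive numbers has polynomial decay if there are constants $c,\alpha>0$ with $\beta_n\ge c\,n^{-\alpha}$ for all $n\ge1$, and polynomial growth if there are constants $C,\gamma>0$ with $\beta_n\le C\,n^{\gamma}$ for all $n\ge1$. $H^2(\beta)$ is the Hilbert space of analytic functions $f(z)=\sum_{n\ge0}a_nz^n$ on $\mathbb{D}$ such that $\|f\|^2=\sum_{n\ge0}|a_n|^2\beta_n<\infty$ (polynomial decay ensures $\liminf_n\beta_n^{1/n}\ge1$, the condition ensuring that such power series are analytic on $\mathbb{D}$). A symbol is a non-constant analytic map $\varphi:\mathbb{D}\to\mathbb{D}$, and $C_\varphi(f)=f\circ\varphi$; it is bounded on $H^2(\beta)$ if it maps $H^2(\beta)$ boundedly into itself. *)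

(* Defs.v *)
From Stdlib Require Import Reals.
From Coquelicot Require Import Coquelicot.

Local Open Scope R_scope.

(** Functions on the unit disk are represented by total functions [C -> C];
    none of the definitions below depends on values outside the disk. *)

Definition in_disk (z : C) : Prop := Cmod z < 1.

(** The derivative is taken over the scalar field [C_AbsRing], so this is
    complex differentiability, not differentiability over [R]. *)
Definition analytic_on_disk (f : C -> C) : Prop :=
  forall z : C, in_disk z -> @ex_derive C_AbsRing C_NormedModule f z.

Definition power_series_on_disk (a : nat -> C) (f : C -> C) : Prop :=
  forall z : C, in_disk z -> @is_pseries C_AbsRing C_NormedModule a z (f z).

Definition positive_seq (beta : nat -> R) : Prop :=
  forall n : nat, 0 < beta n.

Definition polynomial_decay (beta : nat -> R) : Prop :=
  exists c alpha : R, 0 < c /\ 0 < alpha /\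
    forall n : nat, (1 <= n)%nat -> c * Rpower (INR n) (- alpha) <= beta n.

Definition polynomial_growth (beta : nat -> R) : Prop :=
  exists K gamma : R, 0 < K /\ 0 < gamma /\
    forall n : nat, (1 <= n)%nat -> beta n <= K * Rpower (INR n) gamma.

Definition weakly_decreasing (beta : nat -> R) : Prop :=
  forall delta : R, 0 < delta ->
    exists K : R, 0 < K /\
      forall m n : nat, INR m > (1 + delta) * INR n -> beta m <= K * beta n.

Definition in_H2 (beta : nat -> R) (f : C -> C) : Prop :=
  analytic_on_disk f /\
  exists a : nat -> C, power_series_on_disk a f /\
    ex_series (fun n : nat => (Cmod (a n)) ^ 2 * beta n).

(** The norm is a relation because the Taylor coefficients are only given
    existentially; they are determined by [f], hence so is [N]. *)
Definition is_H2_norm (beta : nat -> R) (f : C -> C) (N : R) : Prop :=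
  0 <= N /\
  exists a : nat -> C, power_series_on_disk a f /\
    is_series (fun n : nat => (Cmod (a n)) ^ 2 * beta n) (N ^ 2).

Definition is_symbol (phi : C -> C) : Prop :=
  analytic_on_disk phi /\
  (forall z : C, in_disk z -> in_disk (phi z)) /\
  exists z w : C, in_disk z /\ in_disk w /\ phi z <> phi w.

Definition composition_operator (phi f : C -> C) : C -> C :=
  fun z => f (phi z).

(** Linearity is automatic for composition, so only stability of the space
    and the norm inequality are required. *)
Definition bounded_on_H2 (beta : nat -> R) (T : (C -> C) -> (C -> C)) : Prop :=
  (forall f : C -> C, in_H2 beta f -> in_H2 beta (T f)) /\
  exists M : R, forall (f : C -> C) (N N' : R),
    in_H2 beta f -> is_H2_norm beta f N -> is_H2_norm beta (T f) N' ->
    N' <= M * N.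

(* Main.v *)
(** With [phi(0) = 0], the Taylor coefficients of [f o phi] are [b_m = sum_(n <= m) a_n A_(m,n)],
    [A_(m,n)] being the [m]-th coefficient of [phi^n].  By Littlewood's subordination principle
    [A] is a contraction for the constant weight.  If [|phi'(0)| < 1] then [phi^n = z^n w^n] with
    [|w(0)| < 1], so that [A_(m,n)] is exponentially small in [n] when [m <= (1 + delta) n]; this
    near-diagonal part is Hilbert-Schmidt for every weight between two powers of [n].  The
    remaining part is bounded for the constant weight and only moves [z^n] to powers
    [m > (1 + delta) n], where the decreasing envelope [W_m = sup_(k >= m) beta_k] is at most
    [C(delta) beta_n]; Abel summation against [W] transfers the bound to the weight [beta].
    If [|phi'(0)| = 1] then [phi] is a rotation. *)

Require Import Defs.
From Stdlib Require Import Reals Lra Lia Psatz.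
From Coquelicot Require Import Coquelicot.

Local Open Scope R_scope.

(** * Complex-valued functions of a real variable *)

(** Weak decrease says nothing about [beta m / beta n] when [m] is close to [n]. There the ratio is
    only known to be at most polynomial in [n], so the entries themselves must pay for it.
    Littlewood's principle concerns the whole matrix, not its pieces: the far part is bounded for
    the constant weight only as the difference of the matrix and the near part, which must therefore
    be small for the constant weight as well as for [beta]. All estimates are made on finite sums,
    with constants independent of the truncation. Nothing is lost, because the matrix is triangular:
    [b_m] with [m <= N] only involves [a_0, ..., a_N]. Analyticity is bare complex
    differentiability, so the Taylor coefficients come from Goursat's and Cauchy's theorems, in
    coordinates where [f(w) dw / (w - z)] has no pole. The coefficients of a composite are
    identified through the order of vanishing of a remainder at [0], which avoids rearranging a
    double series. *)

Definition cderiv (f : C -> C) (z l : C) : Prop :=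
  forall eps, 0 < eps -> exists d, 0 < d /\ forall w, Cmod (w - z) < d ->
    Cmod (f w - f z - (w - z) * l) <= eps * Cmod (w - z).

Lemma is_derive_cderiv (f : C -> C) (z l : C) :
  @is_derive C_AbsRing C_NormedModule f z l -> cderiv f z l.
Proof.
  intros [_ H] eps He.
  destruct (H z (fun P HP => HP) (mkposreal eps He)) as [d Hd].
  exists d; split; [apply cond_pos|].
  intros w Hw. exact (Hd w Hw).
Qed.

(** Continuity, integral and derivative along a real parameter are all taken coordinatewise, so that
    the real theorems apply to each part. *)
Definition ccont (f : R -> C) (t : R) : Prop :=
  continuous (fun x => fst (f x)) t /\ continuous (fun x => snd (f x)) t.

Definition ccont_on (f : R -> C) (a b : R) : Prop :=
  forall t, a <= t <= b -> ccont f t.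

Definition cint (f : R -> C) (a b : R) : C :=
  (RInt (fun t => fst (f t)) a b, RInt (fun t => snd (f t)) a b).

Definition rderiv (F : R -> C) (t : R) (l : C) : Prop :=
  is_derive (fun x => fst (F x)) t (fst l) /\ is_derive (fun x => snd (F x)) t (snd l).

Lemma ccont_const (c : C) t : ccont (fun _ => c) t.
Proof. split; apply continuous_const. Qed.

Lemma ccont_plus f g t : ccont f t -> ccont g t -> ccont (fun x => f x + g x)%C t.
Proof.
  intros [H1 H2] [H3 H4]; split; simpl.
  - now apply (continuous_plus (fun x => fst (f x)) (fun x => fst (g x))).
  - now apply (continuous_plus (fun x => snd (f x)) (fun x => snd (g x))).
Qed.

Lemma ccont_mult f g t : ccont f t -> ccont g t -> ccont (fun x => f x * g x)%C t.
Proof.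
  intros [H1 H2] [H3 H4]; split; simpl.
  - apply (continuous_minus (fun x => fst (f x) * fst (g x)) (fun x => snd (f x) * snd (g x)));
    now apply (continuous_mult (K := R_AbsRing)).
  - apply (continuous_plus (fun x => fst (f x) * snd (g x)) (fun x => snd (f x) * fst (g x)));
    now apply (continuous_mult (K := R_AbsRing)).
Qed.

Lemma ccont_opp f t : ccont f t -> ccont (fun x => - f x)%C t.
Proof.
  intros [H1 H2]; split; simpl.
  - now apply (continuous_opp (fun x => fst (f x))).
  - now apply (continuous_opp (fun x => snd (f x))).
Qed.

Lemma ccont_minus f g t : ccont f t -> ccont g t -> ccont (fun x => f x - g x)%C t.
Proof. intros; apply ccont_plus; auto using ccont_opp. Qed.

Lemma ccont_pow f n t : ccont f t -> ccont (fun x => f x ^ n)%C t.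
Proof.
  intros H; induction n as [|n IH]; [apply ccont_const|].
  exact (ccont_mult _ _ _ H IH).
Qed.

Lemma rderiv_ccont F t l : rderiv F t l -> ccont F t.
Proof.
  intros [H1 H2]; split; apply (ex_derive_continuous (K := R_AbsRing) (V := R_NormedModule)); eexists; eassumption.
Qed.

Lemma Rabs_fst_le (z : C) : Rabs (fst z) <= Cmod z.
Proof. apply Rle_trans with (2 := Rmax_Cmod z), Rmax_l. Qed.

Lemma Rabs_snd_le (z : C) : Rabs (snd z) <= Cmod z.
Proof. apply Rle_trans with (2 := Rmax_Cmod z), Rmax_r. Qed.

Lemma Cmod_le_parts (z : C) M : Rabs (fst z) <= M -> Rabs (snd z) <= M -> Cmod z <= 2 * M.
Proof.
  intros H1 H2.
  assert (E : z = (RtoC (fst z) + Ci * RtoC (snd z))%C).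
  { destruct z; unfold RtoC, Ci, Cplus, Cmult; simpl; f_equal; ring. }
  rewrite E. eapply Rle_trans; [apply Cmod_triangle|].
  rewrite Cmod_mult, !Cmod_R, Cmod_Ci. lra.
Qed.

Lemma ccont_eps f t :
  ccont f t <-> forall eps, 0 < eps -> exists d, 0 < d /\
    forall x, Rabs (x - t) < d -> Cmod (f x - f t) < eps.
Proof.
  split.
  - intros [H1 H2] eps He.
    assert (He' : 0 < eps / 3) by lra.
    destruct (proj1 (filterlim_locally _ _) H1 (mkposreal _ He')) as [d1 D1].
    destruct (proj1 (filterlim_locally _ _) H2 (mkposreal _ He')) as [d2 D2].
    exists (Rmin d1 d2); split.
    { apply Rmin_glb_lt; apply cond_pos. }
    intros x Hx.
    apply Rle_lt_trans with (2 * (eps / 3)); [|lra].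
    apply Cmod_le_parts; left.
    + apply (D1 x). eapply Rlt_le_trans; [exact Hx|apply Rmin_l].
    + apply (D2 x). eapply Rlt_le_trans; [exact Hx|apply Rmin_r].
  - intros H; split; apply filterlim_locally; intros eps;
    destruct (H eps (cond_pos eps)) as [d [Hd D]]; exists (mkposreal d Hd);
    intros x Hx; specialize (D x Hx).
    + eapply Rle_lt_trans; [apply (Rabs_fst_le (f x - f t)%C)|exact D].
    + eapply Rle_lt_trans; [apply (Rabs_snd_le (f x - f t)%C)|exact D].
Qed.

Lemma cderiv_cont f z l : cderiv f z l ->
  forall eps, 0 < eps -> exists d, 0 < d /\
    forall w, Cmod (w - z) < d -> Cmod (f w - f z) < eps.
Proof.
  intros H eps He. destruct (H 1 Rlt_0_1) as [d [Hd D]].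
  assert (Hl := Cmod_ge_0 l).
  exists (Rmin d (eps / (2 + Cmod l))); split.
  { apply Rmin_glb_lt; [exact Hd|apply Rdiv_lt_0_compat; lra]. }
  intros w Hw.
  assert (Hw1 := Rlt_le_trans _ _ _ Hw (Rmin_l _ _)).
  assert (Hw2 := Rlt_le_trans _ _ _ Hw (Rmin_r _ _)).
  specialize (D w Hw1).
  replace (f w - f z)%C with ((f w - f z - (w - z) * l) + (w - z) * l)%C by ring.
  eapply Rle_lt_trans; [apply Cmod_triangle|].
  rewrite Cmod_mult.
  apply (Rmult_lt_compat_r (2 + Cmod l)) in Hw2; [|lra].
  unfold Rdiv in Hw2; rewrite Rmult_assoc, Rinv_l in Hw2 by lra.
  assert (H0 := Cmod_ge_0 (w - z)). nra.
Qed.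

Lemma ccont_comp f g t l : cderiv f (g t) l -> ccont g t -> ccont (fun x => f (g x)) t.
Proof.
  intros Hf Hg; apply ccont_eps; intros eps He.
  destruct (cderiv_cont _ _ _ Hf eps He) as [d [Hd D]].
  destruct (proj1 (ccont_eps _ _) Hg d Hd) as [d' [Hd' D']].
  exists d'; split; auto.
Qed.

Lemma ccont_on_ex f a b : a <= b -> ccont_on f a b ->
  ex_RInt (fun t => fst (f t)) a b /\ ex_RInt (fun t => snd (f t)) a b.
Proof.
  intros Hab H; split; apply (ex_RInt_continuous (V := R_CompleteNormedModule));
  intros x; rewrite Rmin_left, Rmax_right by exact Hab; intros Hx; apply (H x Hx).
Qed.

Lemma cint_plus f g a b : a <= b -> ccont_on f a b -> ccont_on g a b ->
  cint (fun t => f t + g t)%C a b = (cint f a b + cint g a b)%C.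
Proof.
  intros Hab Hf Hg.
  destruct (ccont_on_ex f a b Hab Hf), (ccont_on_ex g a b Hab Hg).
  unfold cint, Cplus; simpl; f_equal.
  - now apply (RInt_plus (V := R_CompleteNormedModule)).
  - now apply (RInt_plus (V := R_CompleteNormedModule)).
Qed.

Lemma cint_scal c f a b : a <= b -> ccont_on f a b ->
  cint (fun t => c * f t)%C a b = (c * cint f a b)%C.
Proof.
  intros Hab Hf. destruct (ccont_on_ex f a b Hab Hf) as [H1 H2].
  apply (RInt_correct (V := R_CompleteNormedModule)) in H1.
  apply (RInt_correct (V := R_CompleteNormedModule)) in H2.
  unfold cint, Cmult; simpl; f_equal; apply is_RInt_unique.
  - exact (is_RInt_minus (V := R_NormedModule) _ _ _ _ _ _
      (is_RInt_scal (V := R_NormedModule) _ _ _ (fst c) _ H1)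
      (is_RInt_scal (V := R_NormedModule) _ _ _ (snd c) _ H2)).
  - exact (is_RInt_plus (V := R_NormedModule) _ _ _ _ _ _
      (is_RInt_scal (V := R_NormedModule) _ _ _ (fst c) _ H2)
      (is_RInt_scal (V := R_NormedModule) _ _ _ (snd c) _ H1)).
Qed.

Lemma cint_minus f g a b : a <= b -> ccont_on f a b -> ccont_on g a b ->
  cint (fun t => f t - g t)%C a b = (cint f a b - cint g a b)%C.
Proof.
  intros Hab Hf Hg.
  destruct (ccont_on_ex f a b Hab Hf), (ccont_on_ex g a b Hab Hg).
  unfold cint, Cminus, Cplus, Copp; simpl; f_equal.
  - now apply (RInt_minus (V := R_CompleteNormedModule)).
  - now apply (RInt_minus (V := R_CompleteNormedModule)).
Qed.

Lemma cint_Chasles f a b c : a <= b <= c -> ccont_on f a c ->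
  cint f a c = (cint f a b + cint f b c)%C.
Proof.
  intros [Hab Hbc] Hf.
  destruct (ccont_on_ex f a b) as [H1 H2]; [lra|intros t Ht; apply Hf; lra|].
  destruct (ccont_on_ex f b c) as [H3 H4]; [lra|intros t Ht; apply Hf; lra|].
  unfold cint, Cplus; simpl; f_equal; symmetry.
  - now apply (RInt_Chasles (V := R_CompleteNormedModule)).
  - now apply (RInt_Chasles (V := R_CompleteNormedModule)).
Qed.

Lemma cint_ext f g a b : a <= b -> (forall t, a <= t <= b -> f t = g t) ->
  cint f a b = cint g a b.
Proof.
  intros Hab H. unfold cint; f_equal; apply (RInt_ext (V := R_CompleteNormedModule));
  rewrite Rmin_left, Rmax_right by exact Hab; intros t Ht; rewrite H by lra; reflexivity.
Qed.

(** The factor 2 comes from bounding the two coordinates separately. It is harmless, since the bound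
    only serves to make quantities arbitrarily small. *)
Lemma cint_bound f a b M : a <= b -> ccont_on f a b ->
  (forall t, a <= t <= b -> Cmod (f t) <= M) -> Cmod (cint f a b) <= 2 * ((b - a) * M).
Proof.
  intros Hab Hf HM. destruct (ccont_on_ex f a b Hab Hf) as [H1 H2].
  apply Cmod_le_parts; simpl.
  - refine (norm_RInt_le_const (V := R_NormedModule) (fun t => fst (f t)) a b _ M Hab _
      (RInt_correct (V := R_CompleteNormedModule) _ _ _ H1)).
    intros t Ht. eapply Rle_trans; [apply Rabs_fst_le|auto].
  - refine (norm_RInt_le_const (V := R_NormedModule) (fun t => snd (f t)) a b _ M Hab _
      (RInt_correct (V := R_CompleteNormedModule) _ _ _ H2)).
    intros t Ht. eapply Rle_trans; [apply Rabs_snd_le|auto].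
Qed.

Lemma cint_derive F f a b : a <= b ->
  (forall t, a <= t <= b -> rderiv F t (f t)) -> ccont_on f a b ->
  cint f a b = (F b - F a)%C.
Proof.
  intros Hab HF Hf. unfold cint, Cminus, Cplus, Copp; simpl; f_equal;
  apply is_RInt_unique.
  - apply (is_RInt_derive (V := R_CompleteNormedModule) (fun t => fst (F t)));
    intros x; rewrite Rmin_left, Rmax_right by exact Hab; intros Hx.
    + apply (HF x Hx).
    + apply (Hf x Hx).
  - apply (is_RInt_derive (V := R_CompleteNormedModule) (fun t => snd (F t)));
    intros x; rewrite Rmin_left, Rmax_right by exact Hab; intros Hx.
    + apply (HF x Hx).
    + apply (Hf x Hx).
Qed.

(** Nested intervals with left ends [u n] and lengths [k n]: the supremum of the left ends lies in
    all of them. *)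
Lemma nested_point (u k : nat -> R) :
  (forall n, u n <= u (S n)) -> (forall n, u (S n) + k (S n) <= u n + k n) ->
  (forall n, 0 <= k n) -> exists p, forall n, u n <= p <= u n + k n.
Proof.
  intros Hu Hk H0.
  assert (Hu' : forall n m, (n <= m)%nat -> u n <= u m).
  { intros n m H; induction H; [lra|]. eapply Rle_trans; eauto. }
  assert (Hk' : forall n m, (n <= m)%nat -> u m + k m <= u n + k n).
  { intros n m H; induction H; [lra|]. eapply Rle_trans; eauto. }
  assert (Hnm : forall n m, u n <= u m + k m).
  { intros n m. destruct (Nat.le_ge_cases n m) as [H|H].
    - specialize (Hu' n m H); specialize (H0 m); lra.
    - specialize (Hk' m n H); specialize (H0 n); lra. }
  destruct (completeness (fun x => exists n, x = u n)) as [p [P1 P2]].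
  - exists (u O + k O). intros x [n ->]. apply Hnm.
  - exists (u O). now exists O.
  - exists p. intros n; split; [apply P1; now exists n|].
    apply P2. intros x [m ->]. apply Hnm.
Qed.

(** Goursat's subdivision argument: a quarter of the square with the largest value of [|J|]
    is selected at each step. *)
Lemma bisection_zero (J : R -> R -> R -> C) (a b h : R) : 0 < h ->
  (forall x y k, 0 < k -> a <= x -> x + 2 * k <= a + h -> b <= y -> y + 2 * k <= b + h ->
     J x y (2 * k) = (J x y k + J (x + k)%R y k + (J x (y + k)%R k + J (x + k)%R (y + k)%R k))%C) ->
  (forall p q, a <= p <= a + h -> b <= q <= b + h -> forall eps, 0 < eps ->
     exists d, 0 < d /\ forall x y k, 0 < k < d -> a <= x <= p -> p <= x + k <= a + h ->
       b <= y <= q -> q <= y + k <= b + h -> Cmod (J x y k) <= eps * k ^ 2) ->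
  J a b h = 0.
Proof.
  intros Hh Hadd Hloc.
  (* Some quarter carries at least a fourth of [|J|], whence the factor [4 ^ n]; the area factor
     [k ^ 2] of the local bound will compensate for it. *)
  set (valid := fun n (p : R * R) => a <= fst p /\ fst p + h / 2 ^ n <= a + h /\
    b <= snd p /\ snd p + h / 2 ^ n <= b + h /\
    Cmod (J a b h) <= 4 ^ n * Cmod (J (fst p) (snd p) (h / 2 ^ n))).
  assert (Hpos : forall n, 0 < h / 2 ^ n).
  { intros n; apply Rdiv_lt_0_compat; [lra|apply pow_lt; lra]. }
  assert (Hhalf : forall n, h / 2 ^ n = 2 * (h / 2 ^ S n)).
  { intros n; simpl; field. apply pow_nonzero; lra. }
  (* A sigma type rather than an existential, because the step is iterated by [nat_rect] to define
     the sequence of squares; [Rle_dec] makes the choice of the quarter effective. *)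
  assert (step : forall n (s : {p | valid n p}), {s' : {p | valid (S n) p} |
     (fst (proj1_sig s) <= fst (proj1_sig s') /\
      fst (proj1_sig s') + h / 2 ^ S n <= fst (proj1_sig s) + h / 2 ^ n) /\
     (snd (proj1_sig s) <= snd (proj1_sig s') /\
      snd (proj1_sig s') + h / 2 ^ S n <= snd (proj1_sig s) + h / 2 ^ n)}).
  { intros n [[x y] Hv]; unfold valid in *; cbn [fst snd proj1_sig] in *.
    specialize (Hhalf n). specialize (Hpos (S n)). revert Hpos Hv Hhalf.
    generalize (h / 2 ^ S n) as k. generalize (h / 2 ^ n) as k2.
    intros k2 k Hk (V1 & V2 & V3 & V4 & V5) ->.
    assert (H4 : 0 < 4 ^ n) by (apply pow_lt; lra).
    rewrite (Hadd x y k) in V5 by lra.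
    assert (Hcase : forall x' y', Cmod (J x y (2 * k)) <= 4 * Cmod (J x' y' k) ->
       Cmod (J a b h) <= 4 ^ S n * Cmod (J x' y' k)).
    { intros x' y' H. rewrite (Hadd x y k) in H by lra. simpl. nra. }
    assert (Hmk : forall x' y', (x' = x \/ x' = x + k) -> (y' = y \/ y' = y + k) ->
       Cmod (J x y (2 * k)) <= 4 * Cmod (J x' y' k) ->
       {s' : {p : R * R | a <= fst p /\ fst p + k <= a + h /\ b <= snd p /\ snd p + k <= b + h /\
            Cmod (J a b h) <= 4 ^ S n * Cmod (J (fst p) (snd p) k)} |
        (x <= fst (proj1_sig s') /\ fst (proj1_sig s') + k <= x + 2 * k) /\
        (y <= snd (proj1_sig s') /\ snd (proj1_sig s') + k <= y + 2 * k)}).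
    { intros x' y' Hx Hy HJ.
      assert (P : a <= x' /\ x' + k <= a + h /\ b <= y' /\ y' + k <= b + h /\
            Cmod (J a b h) <= 4 ^ S n * Cmod (J x' y' k)).
      { repeat split; try (destruct Hx, Hy; lra). now apply Hcase. }
      exists (exist _ (x', y') P); simpl. destruct Hx, Hy; lra. }
    destruct (Rle_dec (Cmod (J x y (2 * k))) (4 * Cmod (J x y k))) as [C1|C1].
    { exact (Hmk x y (or_introl eq_refl) (or_introl eq_refl) C1). }
    destruct (Rle_dec (Cmod (J x y (2 * k))) (4 * Cmod (J (x + k) y k))) as [C2|C2].
    { exact (Hmk (x + k) y (or_intror eq_refl) (or_introl eq_refl) C2). }
    destruct (Rle_dec (Cmod (J x y (2 * k))) (4 * Cmod (J x (y + k) k))) as [C3|C3].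
    { exact (Hmk x (y + k) (or_introl eq_refl) (or_intror eq_refl) C3). }
    (* If the other three quarters all fall short of a fourth, the triangle inequality forces the
       last one to reach it. *)
    apply (Hmk (x + k) (y + k) (or_intror eq_refl) (or_intror eq_refl)).
    assert (T := Cmod_triangle (J x y k + J (x + k)%R y k) (J x (y + k)%R k + J (x + k)%R (y + k)%R k)).
    assert (T1 := Cmod_triangle (J x y k) (J (x + k)%R y k)).
    assert (T2 := Cmod_triangle (J x (y + k)%R k) (J (x + k)%R (y + k)%R k)).
    rewrite <- (Hadd x y k) in T by lra. lra. }
  assert (V0 : valid O (a, b)).
  { unfold valid; simpl. unfold Rdiv; rewrite Rinv_1, !Rmult_1_r. repeat split; lra. }
  set (s := nat_rect (fun n => {p | valid n p}) (exist _ (a, b) V0)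
     (fun n s => proj1_sig (step n s))).
  assert (Hs : forall n, s (S n) = proj1_sig (step n (s n))) by reflexivity.
  destruct (nested_point (fun n => fst (proj1_sig (s n))) (fun n => h / 2 ^ n)) as [p Hp].
  { intros n; rewrite Hs. apply (proj2_sig (step n (s n))). }
  { intros n; rewrite Hs. apply (proj2_sig (step n (s n))). }
  { intros n; left; apply Hpos. }
  destruct (nested_point (fun n => snd (proj1_sig (s n))) (fun n => h / 2 ^ n)) as [q Hq].
  { intros n; rewrite Hs. apply (proj2_sig (step n (s n))). }
  { intros n; rewrite Hs. apply (proj2_sig (step n (s n))). }
  { intros n; left; apply Hpos. }
  assert (Hp0 := Hp O); assert (Hq0 := Hq O); simpl in Hp0, Hq0.
  unfold Rdiv in Hp0, Hq0; rewrite Rinv_1, Rmult_1_r in Hp0, Hq0.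
  apply Cmod_eq_0, Rle_antisym; [|apply Cmod_ge_0].
  apply le_epsilon; intros eps He; rewrite Rplus_0_l.
  (* At stage [n] the bound becomes [4 ^ n * (eps / h ^ 2) * (h / 2 ^ n) ^ 2 = eps]. *)
  destruct (Hloc p q Hp0 Hq0 (eps / h ^ 2)) as [d [Hd D]].
  { apply Rdiv_lt_0_compat; [exact He|apply pow_lt; lra]. }
  assert (Hn : exists n, h / 2 ^ n < d).
  { destruct (pow_lt_1_zero (/ 2)) with (y := d / h) as [n Hn].
    - rewrite Rabs_pos_eq; lra.
    - apply Rdiv_lt_0_compat; lra.
    - exists n. specialize (Hn n (Nat.le_refl n)).
      rewrite pow_inv, Rabs_pos_eq in Hn.
      + apply (Rmult_lt_compat_l h) in Hn; [|lra].
        replace (h * (d / h)) with d in Hn by (field; lra). exact Hn.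
      + left; apply Rinv_0_lt_compat, pow_lt; lra. }
  destruct Hn as [n Hn].
  destruct (proj2_sig (s n)) as (V1 & V2 & V3 & V4 & V5).
  specialize (D _ _ _ (conj (Hpos n) Hn) (conj V1 (proj1 (Hp n))) (conj (proj2 (Hp n)) V2)
     (conj V3 (proj1 (Hq n))) (conj (proj2 (Hq n)) V4)).
  eapply Rle_trans; [exact V5|].
  apply Rle_trans with (4 ^ n * (eps / h ^ 2 * (h / 2 ^ n) ^ 2)).
  { apply Rmult_le_compat_l; [left; apply pow_lt; lra|exact D]. }
  replace 4 with (2 * 2) by lra. rewrite Rpow_mult_distr. right; field.
  split; [apply pow_nonzero|]; lra.
Qed.

(** * Goursat's theorem and Cauchy's formula *)

Definition cis (t : R) : C := (cos t, sin t).

(** [gam] shrinks the circle of radius [r] to [z] as [s] goes from [0] to [-oo]; [ker] is chosen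
    so that [d gam = (gam - z) (ds + ker dt)]. *)
Definition gam (r : R) (z : C) (s t : R) : C := (z + RtoC (exp s) * (RtoC r * cis t - z))%C.

Definition ker (r : R) (z : C) (t : R) : C := (Ci * (RtoC r * cis t) / (RtoC r * cis t - z))%C.

Lemma Cmod_cis t : Cmod (cis t) = 1.
Proof.
  unfold Cmod, cis; simpl. rewrite !Rmult_1_r.
  assert (H := sin2_cos2 t). unfold Rsqr in H.
  rewrite Rplus_comm, H. apply sqrt_1.
Qed.

Lemma Cmod_rcis r t : 0 <= r -> Cmod (RtoC r * cis t) = r.
Proof. intros H. rewrite Cmod_mult, Cmod_cis, Cmod_R, Rabs_pos_eq; lra. Qed.

Lemma Cmod_minus_ge (a b : C) : Cmod a - Cmod b <= Cmod (a - b).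
Proof.
  assert (H := Cmod_triangle (a - b) b).
  replace (a - b + b)%C with a in H by ring. lra.
Qed.

Lemma Cmod_minus_le (a b : C) : Cmod (a - b) <= Cmod a + Cmod b.
Proof.
  unfold Cminus. eapply Rle_trans; [apply Cmod_triangle|]. rewrite Cmod_opp. lra.
Qed.

Section Circle.
Variables (r : R) (z : C).
Hypotheses (Hz : Cmod z < r) (Hr : r < 1).

Let r_pos : 0 < r.
Proof. generalize (Cmod_ge_0 z); lra. Qed.

Lemma rcis_minus_ge t : r - Cmod z <= Cmod (RtoC r * cis t - z).
Proof.
  rewrite <- (Cmod_rcis r t) at 1 by lra. apply Cmod_minus_ge.
Qed.

Lemma rcis_minus_neq0 t : (RtoC r * cis t - z)%C <> 0.
Proof.
  intros H. generalize (rcis_minus_ge t). rewrite H, Cmod_0. lra.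
Qed.

(** For [s <= 0] the point is a convex combination of [z] and [r cis t], with weight [exp s] on the
    latter. *)
Lemma gam_in s t : s <= 0 -> Cmod (gam r z s t) <= r.
Proof.
  intros Hs. unfold gam.
  replace (z + RtoC (exp s) * (RtoC r * cis t - z))%C
    with (RtoC (1 - exp s) * z + RtoC (exp s) * (RtoC r * cis t))%C
    by (rewrite RtoC_minus; ring).
  assert (H1 : exp s <= 1).
  { rewrite <- exp_0. destruct Hs as [Hs| ->]; [left; now apply exp_increasing|lra]. }
  assert (H2 := exp_pos s).
  eapply Rle_trans; [apply Cmod_triangle|].
  rewrite !(Cmod_mult (RtoC _)), Cmod_cis, !Cmod_R, !Rabs_pos_eq by lra. nra.
Qed.

Lemma ker_bound t : Cmod (ker r z t) <= r / (r - Cmod z).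
Proof.
  unfold ker. rewrite Cmod_div by apply rcis_minus_neq0.
  rewrite Cmod_mult, Cmod_Ci, Cmod_rcis, Rmult_1_l by lra.
  apply Rmult_le_compat_l; [lra|].
  apply Rinv_le_contravar; [lra|apply rcis_minus_ge].
Qed.

Lemma rderiv_gam_s s t : rderiv (fun s => gam r z s t) s (gam r z s t - z)%C.
Proof.
  unfold gam, rderiv; simpl; split; auto_derive; auto; ring.
Qed.

Lemma rderiv_gam_t s t : rderiv (gam r z s) t ((gam r z s t - z) * ker r z t)%C.
Proof.
  replace ((gam r z s t - z) * ker r z t)%C with (RtoC (exp s) * (Ci * (RtoC r * cis t)))%C
    by (unfold gam, ker; field; apply rcis_minus_neq0).
  unfold gam, cis, rderiv; simpl; split; auto_derive; auto; ring.
Qed.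

Lemma ccont_cis t : ccont cis t.
Proof.
  apply rderiv_ccont with (- sin t, cos t). split; simpl; auto_derive; auto; ring.
Qed.

Lemma ccont_inv (f : R -> C) t : f t <> 0 -> ccont f t -> ccont (fun x => / f x)%C t.
Proof.
  intros H0 Hf.
  assert (H1 := proj1 (Cmod_gt_0 _) H0).
  apply ccont_eps; intros eps He.
  destruct (proj1 (ccont_eps _ _) Hf (Rmin (Cmod (f t) / 2) (eps * (Cmod (f t) ^ 2 / 2)))) as [d [Hd D]].
  { apply Rmin_glb_lt; [lra|]. apply Rmult_lt_0_compat; [exact He|]. nra. }
  exists d; split; [exact Hd|]. intros x Hx. specialize (D x Hx).
  assert (D1 := Rlt_le_trans _ _ _ D (Rmin_l _ _)).
  assert (D2 := Rlt_le_trans _ _ _ D (Rmin_r _ _)).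
  assert (Hx0 : Cmod (f t) / 2 <= Cmod (f x)).
  { assert (T := Cmod_minus_ge (f t) (f x)).
    replace (f t - f x)%C with (- (f x - f t))%C in T by ring. rewrite Cmod_opp in T. lra. }
  assert (Hx1 : f x <> 0) by (apply Cmod_gt_0; lra).
  replace (/ f x - / f t)%C with (- (f x - f t) / (f x * f t))%C by (field; auto).
  rewrite Cmod_div, Cmod_opp, Cmod_mult by now apply Cmult_neq_0.
  apply Rlt_le_trans with (eps * (Cmod (f t) ^ 2 / 2) / (Cmod (f x) * Cmod (f t))).
  - apply Rmult_lt_compat_r; [apply Rinv_0_lt_compat; nra|exact D2].
  - apply Rle_div_l; [nra|]. apply Rmult_le_compat_l; nra.
Qed.

Lemma ccont_ker t : ccont (ker r z) t.
Proof.
  unfold ker, Cdiv.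
  assert (H : ccont (fun t => RtoC r * cis t)%C t)
    by (apply ccont_mult; [apply ccont_const|apply ccont_cis]).
  apply ccont_mult.
  - apply ccont_mult; [apply ccont_const|exact H].
  - apply (ccont_inv (fun t => RtoC r * cis t - z)%C); [apply rcis_minus_neq0|].
    apply ccont_minus; [exact H|apply ccont_const].
Qed.

Lemma exp_lip s p : s <= 0 -> p <= 0 -> Rabs (exp s - exp p) <= Rabs (s - p).
Proof.
  assert (W : forall s p, s <= p -> p <= 0 -> exp p - exp s <= p - s).
  { intros s' p' H1 H2. replace (exp s') with (exp p' * exp (s' - p')) by
      (rewrite <- exp_plus; f_equal; ring).
    assert (E := exp_ineq1_le (s' - p')).
    assert (H3 : exp p' <= 1).
    { rewrite <- exp_0. destruct H2 as [H2| ->]; [left; now apply exp_increasing|lra]. }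
    assert (H4 := exp_pos p'). nra. }
  assert (M : forall s p, s <= p -> exp s <= exp p).
  { intros s' p' [H| ->]; [left; now apply exp_increasing|lra]. }
  intros Hs Hp. destruct (Rle_dec s p) as [H|H].
  - rewrite !Rabs_left1; [specialize (W s p); lra|lra|specialize (M s p H); lra].
  - rewrite !Rabs_pos_eq; [specialize (W p s); lra|lra|specialize (M p s); lra].
Qed.

Lemma cis_lip t q : Cmod (cis t - cis q) <= 2 * Rabs (t - q).
Proof.
  apply Cmod_le_parts; simpl.
  - destruct (MVT_abs cos (fun x => - sin x) q t) as [c [E _]].
    { intros; apply derivable_pt_lim_cos. }
    unfold Rminus in E; rewrite E. rewrite <- (Rmult_1_l (Rabs (t - q))).
    apply Rmult_le_compat_r; [apply Rabs_pos|]. rewrite Rabs_Ropp. apply Rabs_le, SIN_bound.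
  - destruct (MVT_abs sin cos q t) as [c [E _]].
    { intros; apply derivable_pt_lim_sin. }
    unfold Rminus in E; rewrite E. rewrite <- (Rmult_1_l (Rabs (t - q))).
    apply Rmult_le_compat_r; [apply Rabs_pos|]. apply Rabs_le, COS_bound.
Qed.

Lemma gam_lip s t p q : s <= 0 -> p <= 0 ->
  Cmod (gam r z s t - gam r z p q) <= 2 * Rabs (s - p) + 2 * Rabs (t - q).
Proof.
  intros Hs Hp. unfold gam.
  replace (z + RtoC (exp s) * (RtoC r * cis t - z) - (z + RtoC (exp p) * (RtoC r * cis q - z)))%C
    with (RtoC (exp s - exp p) * (RtoC r * cis t - z) + RtoC (exp p) * (RtoC r * (cis t - cis q)))%C
    by (rewrite RtoC_minus; ring).
  eapply Rle_trans; [apply Cmod_triangle|].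
  rewrite !(Cmod_mult (RtoC _)), !Cmod_R.
  assert (H1 : exp p <= 1).
  { rewrite <- exp_0. destruct Hp as [Hp| ->]; [left; now apply exp_increasing|lra]. }
  assert (H2 := exp_pos p). assert (H3 := cis_lip t q). assert (H4 := exp_lip s p Hs Hp).
  assert (H5 : Cmod (RtoC r * cis t - z) <= 2).
  { eapply Rle_trans; [apply Cmod_minus_le|]. rewrite Cmod_rcis; lra. }
  rewrite (Rabs_pos_eq (exp p)), (Rabs_pos_eq r) by lra.
  assert (H6 := Rabs_pos (exp s - exp p)). assert (H7 := Cmod_ge_0 (cis t - cis q)).
  assert (H8 := Cmod_ge_0 (RtoC r * cis t - z)).
  apply Rplus_le_compat.
  - rewrite Rmult_comm. apply Rmult_le_compat; lra.
  - apply Rle_trans with (1 * (1 * Cmod (cis t - cis q))); [|lra].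
    apply Rmult_le_compat; try nra.
Qed.

(** Continuity in each variable separately is enough, since only integrals along the sides of
    squares occur. The class contains both [f] and its affine tangents, hence their difference. *)
Definition adm (f : C -> C) : Prop := forall s t, s <= 0 ->
  ccont (fun s => f (gam r z s t)) s /\ ccont (fun t => f (gam r z s t)) t.

Lemma adm_affine a b : adm (fun w => a + b * (w - z))%C.
Proof.
  intros s t Hs; split; (apply ccont_plus; [apply ccont_const|]);
  (apply ccont_mult; [apply ccont_const|]); (apply ccont_minus; [|apply ccont_const]);
  eapply rderiv_ccont; [apply rderiv_gam_s|apply rderiv_gam_t].
Qed.

Lemma adm_minus f g : adm f -> adm g -> adm (fun w => f w - g w)%C.
Proof.
  intros Hf Hg s t Hs; destruct (Hf s t Hs), (Hg s t Hs); split;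
  now apply (ccont_minus (fun x => f (gam r z _ _)) (fun x => g (gam r z _ _))) ||
  now apply ccont_minus.
Qed.

Lemma adm_analytic f : (forall w, Cmod w < 1 -> exists l, cderiv f w l) -> adm f.
Proof.
  intros H s t Hs. destruct (H (gam r z s t)) as [l Hl].
  { generalize (gam_in s t Hs); lra. }
  split; (eapply ccont_comp; [exact Hl|]); eapply rderiv_ccont;
  [apply rderiv_gam_s|apply rderiv_gam_t].
Qed.

(** Circulation of the form [f(gam) (ds + ker dt)], i.e. of [f(w) dw / (w - z)], around the
    square [[x, x + k] * [y, y + k]]. *)
Definition circ (f : C -> C) (x y k : R) : C :=
  ((cint (fun t => f (gam r z (x + k)%R t) * ker r z t) y (y + k) -
    cint (fun t => f (gam r z x t) * ker r z t) y (y + k)) -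
   (cint (fun s => f (gam r z s (y + k)%R)) x (x + k) -
    cint (fun s => f (gam r z s y)) x (x + k)))%C.

Lemma adm_t f s t : adm f -> s <= 0 -> ccont (fun t => f (gam r z s t) * ker r z t)%C t.
Proof. intros Hf Hs. apply ccont_mult; [now apply Hf|apply ccont_ker]. Qed.

Lemma circ_minus f g x y k : adm f -> adm g -> 0 < k -> x + k <= 0 ->
  circ (fun w => f w - g w)%C x y k = (circ f x y k - circ g x y k)%C.
Proof.
  intros Hf Hg Hk Hx. unfold circ.
  assert (Ht : forall s, s <= 0 ->
    cint (fun t => (f (gam r z s t) - g (gam r z s t)) * ker r z t)%C y (y + k) =
    (cint (fun t => f (gam r z s t) * ker r z t) y (y + k) -
     cint (fun t => g (gam r z s t) * ker r z t) y (y + k))%C).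
  { intros s Hs. rewrite <- cint_minus; [|lra| |].
    - apply cint_ext; [lra|]. intros; ring.
    - intros t _; now apply adm_t.
    - intros t _; now apply adm_t. }
  rewrite !Ht by lra.
  rewrite !cint_minus; try lra; try (intros s Hs; (apply Hf || apply Hg); lra).
  ring.
Qed.

(** The form is [a (ds + ker dt) + b d gam]. In the first term [ker] does not depend on [s], so
    opposite sides cancel; the second is exact. *)
Lemma circ_affine a b x y k : 0 < k -> x + k <= 0 ->
  circ (fun w => a + b * (w - z))%C x y k = 0.
Proof.
  intros Hk Hx. unfold circ.
  assert (Hc1 : forall s, s <= 0 -> ccont_on (fun t => (gam r z s t - z) * ker r z t)%C y (y + k)).
  { intros s Hs t _. apply ccont_mult; [|apply ccont_ker].
    apply ccont_minus; [|apply ccont_const]. eapply rderiv_ccont, rderiv_gam_t. }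
  assert (Hc2 : forall t, ccont_on (fun s => gam r z s t - z)%C x (x + k)).
  { intros t s _. apply ccont_minus; [|apply ccont_const]. eapply rderiv_ccont, rderiv_gam_s. }
  assert (Ht : forall s, s <= 0 ->
    cint (fun t => (a + b * (gam r z s t - z)) * ker r z t)%C y (y + k) =
    (a * cint (ker r z) y (y + k) + b * (gam r z s (y + k)%R - gam r z s y))%C).
  { intros s Hs. rewrite <- (cint_derive (gam r z s) (fun t => (gam r z s t - z) * ker r z t)%C).
    2: lra. 2: intros t _; apply rderiv_gam_t. 2: now apply Hc1.
    rewrite <- !cint_scal; [|lra|now apply Hc1|lra|intros t _; apply ccont_ker].
    rewrite <- cint_plus; [|lra| |].
    - apply cint_ext; [lra|]. intros; ring.
    - intros t _; apply ccont_mult; [apply ccont_const|apply ccont_ker].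
    - intros t Ht; apply ccont_mult; [apply ccont_const|]. now apply (Hc1 s Hs). }
  assert (Hs : forall t,
    cint (fun s => a + b * (gam r z s t - z))%C x (x + k) =
    (a * cint (fun _ => RtoC 1) x (x + k) + b * (gam r z (x + k)%R t - gam r z x t))%C).
  { intros t. rewrite <- (cint_derive (fun s => gam r z s t) (fun s => gam r z s t - z)%C).
    2: lra. 2: intros s _; apply rderiv_gam_s. 2: now apply Hc2.
    rewrite <- !cint_scal; [|lra|now apply Hc2|lra|intros s _; apply ccont_const].
    rewrite <- cint_plus; [|lra| |].
    - apply cint_ext; [lra|]. intros; ring.
    - intros s _; apply ccont_mult; apply ccont_const.
    - intros s Hs; apply ccont_mult; [apply ccont_const|]. now apply (Hc2 t). }
  rewrite !Ht, !Hs by lra. ring.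
Qed.

(** The 8 is four sides times the factor 2 of [cint_bound]. The sides along [s] carry no [ker], but
    are given the same bound because [r / (r - Cmod z) >= 1]. *)
Lemma circ_bound f x y k M : adm f -> 0 < k -> x + k <= 0 ->
  (forall s t, x <= s <= x + k -> y <= t <= y + k -> Cmod (f (gam r z s t)) <= M) ->
  Cmod (circ f x y k) <= 8 * (r / (r - Cmod z)) * (k * M).
Proof.
  intros Hf Hk Hx HM. unfold circ.
  set (K := r / (r - Cmod z)).
  assert (HK : 1 <= K).
  { unfold K. apply Rle_div_r; generalize (Cmod_ge_0 z); lra. }
  assert (HM0 : 0 <= M).
  { eapply Rle_trans; [apply Cmod_ge_0|apply (HM x y); lra]. }
  assert (Ht : forall s, x <= s <= x + k ->
    Cmod (cint (fun t => f (gam r z s t) * ker r z t)%C y (y + k)) <= 2 * (k * (M * K))).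
  { intros s Hs. replace (2 * (k * (M * K))) with (2 * ((y + k - y) * (M * K))) by ring.
    apply cint_bound; [lra| |].
    - intros t _; apply adm_t; [exact Hf|lra].
    - intros t Ht. rewrite Cmod_mult. apply Rmult_le_compat; try apply Cmod_ge_0.
      + now apply HM.
      + apply ker_bound. }
  assert (Hs : forall t, y <= t <= y + k ->
    Cmod (cint (fun s => f (gam r z s t)) x (x + k)) <= 2 * (k * (M * K))).
  { intros t Ht'. apply Rle_trans with (2 * ((x + k - x) * M)).
    - apply cint_bound; [lra| |].
      + intros s Hs; apply Hf; lra.
      + intros s Hs. now apply HM.
    - replace (x + k - x) with k by ring.
      assert (P : 0 <= k * M * (K - 1)) by (repeat apply Rmult_le_pos; lra). lra. }
  assert (A1 := Ht (x + k) ltac:(lra)). assert (A2 := Ht x ltac:(lra)).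
  assert (A3 := Hs (y + k) ltac:(lra)). assert (A4 := Hs y ltac:(lra)).
  eapply Rle_trans; [apply Cmod_minus_le|].
  eapply Rle_trans; [apply Rplus_le_compat; apply Cmod_minus_le|].
  lra.
Qed.

Lemma circ_add f x y k : adm f -> 0 < k -> x + 2 * k <= 0 ->
  circ f x y (2 * k) = (circ f x y k + circ f (x + k) y k +
    (circ f x (y + k) k + circ f (x + k) (y + k) k))%C.
Proof.
  intros Hf Hk Hx. unfold circ.
  replace (x + 2 * k) with (x + k + k) by ring. replace (y + 2 * k) with (y + k + k) by ring.
  rewrite !(cint_Chasles _ y (y + k) (y + k + k)); try lra;
    try (intros t _; apply adm_t; [exact Hf|lra]).
  rewrite !(cint_Chasles _ x (x + k) (x + k + k)); try lra;
    try (intros s Hs; apply Hf; lra).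
  ring.
Qed.

(** Near a point the affine tangent of [f] has zero circulation, and the remainder is [o(k)] on a
    path of length [O(k)]: this is the local bound that [bisection_zero] requires. *)
Lemma goursat f x y h : (forall w, Cmod w < 1 -> exists l, cderiv f w l) ->
  0 < h -> x + h <= 0 -> circ f x y h = 0.
Proof.
  intros Hf Hh Hx. assert (Ha := adm_analytic f Hf).
  apply bisection_zero; [exact Hh| |].
  { intros; apply circ_add; [exact Ha|lra|lra]. }
  intros p q Hp Hq eps He.
  set (K := r / (r - Cmod z)).
  assert (HK : 1 <= K).
  { unfold K. apply Rle_div_r; generalize (Cmod_ge_0 z); lra. }
  destruct (Hf (gam r z p q)) as [l Hl].
  { generalize (gam_in p q ltac:(lra)); lra. }
  (* [circ_bound] then gives [8 * K * k * (eps / (32 * K)) * (4 * k) = eps * k ^ 2], where [4 * k]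
     is the distance to the base point allowed by [gam_lip]. *)
  destruct (Hl (eps / (32 * K))) as [d [Hd D]].
  { apply Rdiv_lt_0_compat; lra. }
  exists (d / 4); split; [lra|].
  intros x' y' k Hk H1 H2 H3 H4.
  set (w0 := gam r z p q) in *.
  (* The tangent at [w0] is recentred at [z], the form that [circ_affine] treats. *)
  set (a := (f w0 - (w0 - z) * l)%C).
  replace (circ f x' y' k) with (circ (fun w => f w - (a + l * (w - z)))%C x' y' k).
  2: { rewrite (circ_minus f (fun w => a + l * (w - z))%C), circ_affine; try lra.
       - ring.
       - exact Ha.
       - apply adm_affine. }
  eapply Rle_trans.
  - apply (circ_bound _ x' y' k (eps / (32 * K) * (4 * k))); [|lra|lra|].
    + apply (adm_minus f (fun w => a + l * (w - z))%C); [exact Ha|apply adm_affine].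
    + intros s t Hs Ht.
      assert (L := gam_lip s t p q ltac:(lra) ltac:(lra)). fold w0 in L.
      assert (L' : Cmod (gam r z s t - w0) <= 4 * k).
      { eapply Rle_trans; [exact L|].
        assert (Rabs (s - p) <= k) by (apply Rabs_le; lra).
        assert (Rabs (t - q) <= k) by (apply Rabs_le; lra). lra. }
      specialize (D (gam r z s t) ltac:(lra)).
      replace (f (gam r z s t) - (a + l * (gam r z s t - z)))%C with
        (f (gam r z s t) - f w0 - (gam r z s t - w0) * l)%C by (unfold a; ring).
      eapply Rle_trans; [exact D|]. apply Rmult_le_compat_l; [|exact L'].
      left; apply Rdiv_lt_0_compat; lra.
  - fold K. right; field; lra.
Qed.

Lemma cis_period t : cis (t + 2 * PI) = cis t.
Proof.
  generalize (cos_period t 1) (sin_period t 1). simpl INR. rewrite Rmult_1_r.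
  unfold cis. intros -> ->. reflexivity.
Qed.

(** By Goursat the integral over the shrunk circle is the same for arbitrarily negative [s], and
    there [f] is nearly constant, equal to [f z]. The value of the kernel integral is left open
    here. *)
Lemma cauchy_kernel f : (forall w, Cmod w < 1 -> exists l, cderiv f w l) ->
  cint (fun t => f (RtoC r * cis t) * ker r z t)%C 0 (2 * PI) =
  (f z * cint (ker r z) 0 (2 * PI))%C.
Proof.
  intros Hf. assert (Ha := adm_analytic f Hf). assert (HPI := PI_RGT_0).
  set (I := fun s => cint (fun t => f (gam r z s t) * ker r z t)%C 0 (2 * PI)).
  (* With side [2 * PI] the sides [t = 0] and [t = 2 * PI] cancel by periodicity. As [circ] only
     treats squares, [s] also moves by [2 * PI]. *)
  assert (Hstep : forall s, s + 2 * PI <= 0 -> I (s + 2 * PI) = I s).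
  { intros s Hs. assert (G := goursat f s 0 (2 * PI) Hf ltac:(lra) Hs).
    unfold circ in G. rewrite Rplus_0_l in G. fold (I (s + 2 * PI)) (I s) in G.
    rewrite (cint_ext (fun s => f (gam r z s (2 * PI))) (fun s => f (gam r z s 0)) s (s + 2 * PI)) in G.
    - revert G. generalize (I (s + 2 * PI)) (I s) (cint (fun s => f (gam r z s 0)) s (s + 2 * PI)).
      intros u v w G. replace u with (u - v - (w - w) + v)%C by ring. rewrite G. ring.
    - lra.
    - intros t _. unfold gam. rewrite <- (cis_period 0), Rplus_0_l. reflexivity. }
  assert (Hn : forall n, I (- (INR n * (2 * PI))) = I 0).
  { induction n as [|n IH].
    - simpl. rewrite Rmult_0_l, Ropp_0. reflexivity.
    - rewrite <- IH, <- Hstep; [f_equal|]; rewrite S_INR; [ring|].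
      assert (0 <= INR n * (2 * PI)) by (apply Rmult_le_pos; [apply pos_INR|lra]). lra. }
  replace (cint (fun t => f (RtoC r * cis t) * ker r z t)%C 0 (2 * PI)) with (I 0).
  2: { apply cint_ext; [lra|]. intros t _. f_equal. f_equal. unfold gam. rewrite exp_0. ring. }
  set (K := r / (r - Cmod z)).
  assert (HK : 1 <= K).
  { unfold K. apply Rle_div_r; generalize (Cmod_ge_0 z); lra. }
  set (D := (I 0 - f z * cint (ker r z) 0 (2 * PI))%C).
  enough (HD : Cmod D <= 0).
  { assert (E : D = 0) by (apply Cmod_eq_0, Rle_antisym; [exact HD|apply Cmod_ge_0]).
    replace (I 0) with (D + f z * cint (ker r z) 0 (2 * PI))%C by (unfold D; ring).
    rewrite E. ring. }
  apply le_epsilon; intros eps He; rewrite Rplus_0_l.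
  destruct (Hf z ltac:(lra)) as [l Hl].
  destruct (cderiv_cont f z l Hl (eps / (4 * PI * K))) as [d [Hd Dd]].
  { apply Rdiv_lt_0_compat; [exact He|]. nra. }
  (* Since [|r cis t - z| <= 2], the shrunk circle then lies within [d] of [z]. *)
  assert (HnN : exists n, exp (- (INR n * (2 * PI))) < d / 2).
  { destruct (INR_unbounded (- ln (d / 2))) as [n Hn'].
    exists n. rewrite <- (exp_ln (d / 2)) by lra. apply exp_increasing.
    assert (INR n <= INR n * (2 * PI)); [|lra].
    assert (P1 : 1 <= 2 * PI) by (generalize PI2_1; lra).
    generalize (pos_INR n); nra. }
  destruct HnN as [n HnN].
  set (s := - (INR n * (2 * PI))) in *.
  assert (Hs : s <= 0).
  { unfold s. assert (0 <= INR n * (2 * PI)) by (apply Rmult_le_pos; [apply pos_INR|lra]). lra. }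
  replace D with (cint (fun t => f (gam r z s t) * ker r z t - f z * ker r z t)%C 0 (2 * PI)).
  2: { unfold D. rewrite <- (Hn n). fold s. rewrite cint_minus, cint_scal; try lra.
       - reflexivity.
       - intros t _; apply ccont_ker.
       - intros t _; now apply adm_t.
       - intros t _; apply ccont_mult; [apply ccont_const|apply ccont_ker]. }
  eapply Rle_trans.
  - apply (cint_bound _ _ _ (eps / (4 * PI * K) * K)); [lra| |].
    + intros t _. apply ccont_minus; [now apply adm_t|].
      apply ccont_mult; [apply ccont_const|apply ccont_ker].
    + intros t _.
      replace (f (gam r z s t) * ker r z t - f z * ker r z t)%C with
        ((f (gam r z s t) - f z) * ker r z t)%C by ring.
      rewrite Cmod_mult. apply Rmult_le_compat; try apply Cmod_ge_0; [|apply ker_bound].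
      left; apply Dd. unfold gam.
      replace (z + RtoC (exp s) * (RtoC r * cis t - z) - z)%C
        with (RtoC (exp s) * (RtoC r * cis t - z))%C by ring.
      rewrite Cmod_mult, Cmod_R, Rabs_pos_eq by (left; apply exp_pos).
      assert (H5 : Cmod (RtoC r * cis t - z) <= 2).
      { eapply Rle_trans; [apply Cmod_minus_le|]. rewrite Cmod_rcis; lra. }
      assert (H6 := exp_pos s). nra.
  - right. field. split; lra.
Qed.

End Circle.

(** * Finite sums and polynomials *)

(** [sum_n] puts equations in the carrier of an abstract monoid, where [ring] fails. *)
Ltac cring := lazymatch goal with |- @eq _ ?a ?b => change (@eq C a b) end; ring.
Ltac rring := lazymatch goal with |- @eq _ ?a ?b => change (@eq R a b) end; ring.

Lemma csum_S (a : nat -> C) n : sum_n a (S n) = (sum_n a n + a (S n))%C.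
Proof. exact (sum_Sn a n). Qed.

Lemma csum_O (a : nat -> C) : sum_n a 0 = a 0%nat.
Proof. exact (sum_O a). Qed.

Lemma rsum_S (a : nat -> R) n : sum_n a (S n) = sum_n a n + a (S n).
Proof. exact (sum_Sn a n). Qed.

Lemma rsum_O (a : nat -> R) : sum_n a 0 = a 0%nat.
Proof. exact (sum_O a). Qed.

Lemma csum_plus (a b : nat -> C) n :
  sum_n (fun k => a k + b k)%C n = (sum_n a n + sum_n b n)%C.
Proof. exact (sum_n_plus a b n). Qed.

Lemma csum_scal (c : C) (a : nat -> C) n : sum_n (fun k => c * a k)%C n = (c * sum_n a n)%C.
Proof. exact (sum_n_mult_l (K := C_Ring) c a n). Qed.

Lemma csum_minus (a b : nat -> C) n :
  sum_n (fun k => a k - b k)%C n = (sum_n a n - sum_n b n)%C.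
Proof.
  induction n as [|n IH]; [now rewrite !csum_O|]. rewrite !csum_S, IH. cring.
Qed.

Lemma rsum_plus (a b : nat -> R) n : sum_n (fun k => a k + b k) n = sum_n a n + sum_n b n.
Proof. exact (sum_n_plus a b n). Qed.

Lemma rsum_scal (c : R) (a : nat -> R) n : sum_n (fun k => c * a k) n = c * sum_n a n.
Proof. exact (sum_n_mult_l (K := R_Ring) c a n). Qed.

Lemma rsum_le (a b : nat -> R) n : (forall k, (k <= n)%nat -> a k <= b k) ->
  sum_n a n <= sum_n b n.
Proof.
  intros H. induction n as [|n IH]; [rewrite !rsum_O; auto|].
  rewrite !rsum_S. apply Rplus_le_compat; auto.
Qed.

Lemma rsum_ge0 (a : nat -> R) n : (forall k, (k <= n)%nat -> 0 <= a k) -> 0 <= sum_n a n.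
Proof.
  intros H. induction n as [|n IH]; [rewrite !rsum_O; auto|].
  rewrite !rsum_S. apply Rplus_le_le_0_compat; auto.
Qed.

Lemma rsum_incr (a : nat -> R) n m : (forall k, 0 <= a k) -> (n <= m)%nat ->
  sum_n a n <= sum_n a m.
Proof.
  intros H Hnm. induction Hnm; [lra|]. rewrite rsum_S. specialize (H (S m)). lra.
Qed.

Lemma rsum_term (a : nat -> R) n k : (forall k, 0 <= a k) -> (k <= n)%nat -> a k <= sum_n a n.
Proof.
  intros H Hk. apply Rle_trans with (sum_n a k); [|now apply rsum_incr].
  destruct k; [rewrite rsum_O; lra|]. rewrite rsum_S.
  assert (0 <= sum_n a k) by now apply rsum_ge0. lra.
Qed.

Lemma Cmod_csum (a : nat -> C) n : Cmod (sum_n a n) <= sum_n (fun k => Cmod (a k)) n.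
Proof.
  induction n as [|n IH]; [rewrite csum_O, rsum_O; lra|].
  rewrite csum_S, rsum_S. eapply Rle_trans; [apply Cmod_triangle|]. lra.
Qed.

Lemma csum_shift (a : nat -> C) n :
  sum_n a (S n) = (a 0%nat + sum_n (fun k => a (S k)) n)%C.
Proof.
  induction n as [|n IH]; [now rewrite csum_S, !csum_O|].
  rewrite csum_S, IH, csum_S. cring.
Qed.

Lemma rsum_shift (a : nat -> R) n : sum_n a (S n) = a 0%nat + sum_n (fun k => a (S k)) n.
Proof.
  induction n as [|n IH]; [now rewrite rsum_S, !rsum_O|].
  rewrite rsum_S, IH, rsum_S. lra.
Qed.

Lemma rsum_geom x n : 0 <= x < 1 -> sum_n (fun k => x ^ k) n <= / (1 - x).
Proof.
  intros Hx. enough (E : sum_n (fun k => x ^ k) n = (1 - x ^ S n) / (1 - x)).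
  { rewrite E. rewrite <- (Rmult_1_l (/ (1 - x))). apply Rmult_le_compat_r.
    - left; apply Rinv_0_lt_compat; lra.
    - assert (0 <= x ^ S n) by (apply pow_le; lra). lra. }
  induction n as [|n IH]; [rewrite rsum_O; simpl; field; lra|].
  rewrite rsum_S, IH. simpl. field. lra.
Qed.

(** * Coefficient sequences: partial sums, Cauchy products and powers *)

Definition cpoly (a : nat -> C) (n : nat) (z : C) : C := sum_n (fun k => a k * z ^ k)%C n.

Definition conv (a b : nat -> C) (m : nat) : C := sum_n (fun i => a i * b (m - i)%nat)%C m.

(** [cpow c n m] is the matrix entry [A_(m,n)]; [cpow c 0] is the unit of [conv]. *)
Fixpoint cpow (c : nat -> C) (n : nat) : nat -> C :=
  match n with
  | O => fun m => match m with O => RtoC 1 | _ => RtoC 0 end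
  | S n => conv c (cpow c n)
  end.

Lemma cpoly_S a n z : cpoly a (S n) z = (cpoly a n z + a (S n) * z ^ S n)%C.
Proof. apply csum_S. Qed.

Lemma cpoly_O a z : cpoly a 0 z = a 0%nat.
Proof. unfold cpoly. rewrite csum_O. simpl. cring. Qed.

(** Grouping by the index of [a] leaves [b] truncated at the complementary degree [n - i]. Against
    the full product, each term thus misses only a tail of [b]. *)
Lemma conv_poly a b n z :
  cpoly (conv a b) n z = sum_n (fun i => a i * z ^ i * cpoly b (n - i) z)%C n.
Proof.
  induction n as [|n IH].
  - rewrite cpoly_O, csum_O. unfold conv. rewrite csum_O. simpl. rewrite cpoly_O. cring.
  - rewrite cpoly_S, IH, csum_S. unfold conv. rewrite csum_S.
    rewrite Nat.sub_diag, cpoly_O.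
    rewrite (sum_n_ext_loc (fun i => a i * z ^ i * cpoly b (S n - i) z)%C
      (fun i => a i * z ^ i * cpoly b (n - i) z + z ^ S n * (a i * b (S n - i)%nat))%C).
    + rewrite csum_plus, csum_scal. cring.
    + intros i Hi. replace (S n - i)%nat with (S (n - i)) by lia.
      rewrite cpoly_S.
      replace (z ^ S n)%C with (z ^ i * z ^ S (n - i))%C.
      * cring.
      * rewrite <- Cpow_add_r. f_equal. lia.
Qed.

Lemma csum_zero (a : nat -> C) n : (forall k, (k <= n)%nat -> a k = 0) -> sum_n a n = RtoC 0.
Proof.
  intros H. induction n as [|n IH]; [rewrite csum_O; auto|].
  rewrite csum_S, IH by auto. rewrite H by lia. cring.
Qed.

Lemma conv_ext a b a' b' m : (forall k, (k <= m)%nat -> a k = a' k) ->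
  (forall k, (k <= m)%nat -> b k = b' k) -> conv a b m = conv a' b' m.
Proof.
  intros Ha Hb. apply sum_n_ext_loc. intros i Hi. rewrite Ha, Hb by lia. reflexivity.
Qed.

(** Triangularity of the matrix: a series without constant term has an [n]-th power divisible by
    [z ^ n]. *)
Lemma cpow_low (c : nat -> C) n m : c 0%nat = 0 -> (m < n)%nat -> cpow c n m = 0.
Proof.
  intros Hc. revert m. induction n as [|n IH]; intros m Hm; [lia|].
  simpl. unfold conv. apply csum_zero. intros i Hi. destruct i as [|i].
  - rewrite Hc. cring.
  - rewrite IH by lia. cring.
Qed.

(** * Taylor expansion *)

Lemma is_pseries_eps (a : nat -> C) (z l : C) :
  @is_pseries C_AbsRing C_NormedModule a z l <->
  forall eps, 0 < eps -> exists N, forall n, (N <= n)%nat -> Cmod (cpoly a n z - l) < eps.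
Proof.
  assert (E : forall n, sum_n (G := NormedModule.AbelianMonoid C_AbsRing C_NormedModule)
    (fun k => scal (pow_n (K := C_AbsRing) z k) (a k)) n = cpoly a n z).
  { intros n. unfold cpoly. apply (sum_n_ext (G := C_AbelianMonoid)). intros k.
    rewrite Cmult_comm. change (z ^ k)%C with (pow_n (K := C_Ring) z k). reflexivity. }
  split.
  - intros H eps He.
    destruct (proj1 (filterlim_locally_ball_norm (K := C_AbsRing) (U := C_NormedModule) _ _)
      H (mkposreal eps He)) as [N HN].
    exists N. intros n Hn. specialize (HN n Hn). unfold ball_norm in HN.
    rewrite E in HN. exact HN.
  - intros H. apply (proj2 (filterlim_locally_ball_norm (K := C_AbsRing) (U := C_NormedModule) _ _)).
    intros eps. destruct (H eps (cond_pos eps)) as [N HN]. exists N. intros n Hn.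
    unfold ball_norm. rewrite E. exact (HN n Hn).
Qed.

Lemma eq_of_close (u v : C) : (forall eps, 0 < eps -> Cmod (u - v) <= eps) -> u = v.
Proof.
  intros H. assert (E : (u - v)%C = 0).
  { apply Cmod_eq_0, Rle_antisym; [|apply Cmod_ge_0].
    apply le_epsilon; intros eps He; rewrite Rplus_0_l; auto. }
  replace u with (u - v + v)%C by ring. rewrite E. ring.
Qed.

Lemma pow_small x eps : 0 <= x < 1 -> 0 < eps -> exists N, forall n, (N <= n)%nat -> x ^ n < eps.
Proof.
  intros Hx He. destruct (pow_lt_1_zero x) with (y := eps) as [N HN].
  - rewrite Rabs_pos_eq; lra.
  - exact He.
  - exists N. intros n Hn. specialize (HN n Hn).
    rewrite Rabs_pos_eq in HN; [exact HN|]. apply pow_le; lra.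
Qed.

Lemma ccont_on_bounded f a b : ccont_on f a b ->
  exists M, forall t, a <= t <= b -> Cmod (f t) <= M.
Proof.
  intros H.
  destruct (bounded_continuity (V := R_NormedModule) (fun t => fst (f t)) a b) as [M1 H1].
  { intros t Ht. apply (H t Ht). }
  destruct (bounded_continuity (V := R_NormedModule) (fun t => snd (f t)) a b) as [M2 H2].
  { intros t Ht. apply (H t Ht). }
  exists (2 * Rmax M1 M2). intros t Ht. apply Cmod_le_parts.
  - left. eapply Rlt_le_trans; [apply (H1 t Ht)|apply Rmax_l].
  - left. eapply Rlt_le_trans; [apply (H2 t Ht)|apply Rmax_r].
Qed.

(** The integrand is a constant multiple of its own derivative, and is periodic. *)
Lemma cint_cis_pow n : cint (fun t => cis (- t) ^ S n)%C 0 (2 * PI) = 0.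
Proof.
  assert (HPI := PI_RGT_0).
  assert (D : forall m t, rderiv (fun t => cis (- t) ^ m)%C t
    (RtoC (INR m) * (- Ci) * cis (- t) ^ m)%C).
  { induction m as [|m IH]; intros t.
    - simpl. split; simpl; auto_derive; auto; ring.
    - destruct (IH t) as [I1 I2]. change (cis (- t) ^ S m)%C with (cis (- t) * cis (- t) ^ m)%C.
      rewrite S_INR. revert I1 I2. simpl Cpow.
      set (g := fun x => (cis (- x) ^ m)%C). change (cis (- t) ^ m)%C with (g t).
      intros I1 I2. split; simpl.
      + evar_last.
        * apply (is_derive_minus (V := R_NormedModule) (fun x => cos (- x) * fst (g x))
            (fun x => sin (- x) * snd (g x)));
          apply (is_derive_mult (K := R_AbsRing)); try eassumption; try (exact Rmult_comm);
          auto_derive; auto; reflexivity.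
        * simpl. unfold minus, plus, opp, mult; simpl. ring.
      + evar_last.
        * apply (is_derive_plus (V := R_NormedModule) (fun x => cos (- x) * snd (g x))
            (fun x => sin (- x) * fst (g x)));
          apply (is_derive_mult (K := R_AbsRing)); try eassumption; try (exact Rmult_comm);
          auto_derive; auto; reflexivity.
        * simpl. unfold minus, plus, opp, mult; simpl. ring. }
  assert (Hn : RtoC (INR (S n)) <> 0).
  { intros H. apply (f_equal fst) in H. exact (not_0_INR (S n) (Nat.neq_succ_0 n) H). }
  assert (Hc : forall m t, ccont (fun t => cis (- t) ^ m)%C t).
  { intros m t. eapply rderiv_ccont, D. }
  assert (HCi : Ci <> 0).
  { intros H. apply (f_equal snd) in H. simpl in H. lra. }
  replace (cint (fun t => cis (- t) ^ S n)%C 0 (2 * PI)) with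
    (/ (RtoC (INR (S n)) * - Ci) * (RtoC (INR (S n)) * - Ci * cint (fun t => cis (- t) ^ S n)%C 0 (2 * PI)))%C.
  2: { field. split; assumption. }
  rewrite <- cint_scal; [|lra|intros t _; apply Hc].
  rewrite (cint_derive (fun t => cis (- t) ^ S n)%C); [|lra| |].
  - replace (cis (- (2 * PI))) with (cis (- 0)); [ring|].
    rewrite <- (cis_period (- (2 * PI))). f_equal. ring.
  - intros t _. apply D.
  - intros t _. apply ccont_mult; [apply ccont_const|apply Hc].
Qed.

Section Expansion.
Variables (r : R) (z : C).
Hypotheses (Hz : Cmod z < r) (Hr : r < 1).

Let r_pos : 0 < r.
Proof. generalize (Cmod_ge_0 z); lra. Qed.

(** This is [(r cis t) ^ (-n)], written without inverting a function of [t]. *)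
Let e (n : nat) (t : R) : C := (RtoC (/ r) ^ n * cis (- t) ^ n)%C.

Lemma cis_inv t : (cis t * cis (- t))%C = 1.
Proof.
  unfold cis, Cmult; simpl. rewrite cos_neg, sin_neg.
  assert (H := sin2_cos2 t). unfold Rsqr in H.
  apply injective_projections; simpl; lra.
Qed.

Let ccont_e n t : ccont (e n) t.
Proof.
  apply ccont_mult; [apply ccont_const|]. apply (ccont_pow (fun t => cis (- t))).
  apply rderiv_ccont with (sin (- t), - cos (- t)).
  split; simpl; auto_derive; auto; ring.
Qed.

Let Cmod_e n t : Cmod (e n t) = (/ r) ^ n.
Proof.
  unfold e. rewrite Cmod_mult, !Cmod_pow, Cmod_cis, pow1, Rmult_1_r, Cmod_R, Rabs_pos_eq.
  - reflexivity.
  - left; now apply Rinv_0_lt_compat.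
Qed.

(** The remainder of the finite geometric expansion of [ker] is [z^(n+1) e_(n+1) ker]. *)
Let ker_step n t : (z ^ n * e n t * ker r z t = Ci * (z ^ n * e n t) + z ^ S n * e (S n) t * ker r z t)%C.
Proof.
  assert (H : (RtoC r * cis t - z)%C <> 0) by now apply rcis_minus_neq0.
  assert (E : (z ^ S n * e (S n) t = z ^ n * e n t * (z * (RtoC (/ r) * cis (- t))))%C).
  { unfold e. simpl. ring. }
  rewrite E. unfold ker.
  assert (E2 : (RtoC r * cis t * (RtoC (/ r) * cis (- t)))%C = 1).
  { replace (RtoC r * cis t * (RtoC (/ r) * cis (- t)))%C with
      (RtoC r * RtoC (/ r) * (cis t * cis (- t)))%C by ring.
    rewrite cis_inv, <- RtoC_mult, Rinv_r by lra. ring. }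
  generalize dependent (RtoC (/ r) * cis (- t))%C. intros u _ E2.
  generalize dependent (RtoC r * cis t)%C. intros w Hw E2.
  transitivity (z ^ n * e n t * (Ci * w / (w - z)))%C; [reflexivity|].
  transitivity (z ^ n * e n t * (Ci * (w - z) + z * (u * w) * Ci) / (w - z))%C.
  - rewrite (Cmult_comm u), E2. field. exact Hw.
  - field. exact Hw.
Qed.

(** Iterating [ker_step] leaves a remainder of order [(Cmod z / r) ^ (n + 1)]. A general [g] is
    allowed because the expansion is used both for [f] and for the constant 1. *)
Lemma ker_expand g : (forall t, 0 <= t <= 2 * PI -> ccont g t) ->
  forall eps, 0 < eps -> exists N, forall n, (N <= n)%nat ->
    Cmod (cint (fun t => g t * ker r z t)%C 0 (2 * PI) -
      Ci * cpoly (fun k => cint (fun t => g t * e k t)%C 0 (2 * PI)) n z) < eps.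
Proof.
  intros Hg. assert (HPI := PI_RGT_0).
  destruct (ccont_on_bounded g 0 (2 * PI) Hg) as [B HB].
  assert (HB0 : 0 <= B).
  { eapply Rle_trans; [apply Cmod_ge_0|apply (HB 0); lra]. }
  assert (Hge : forall n t, 0 <= t <= 2 * PI -> ccont (fun t => g t * e n t)%C t).
  { intros n t Ht. apply ccont_mult; [now apply Hg|apply ccont_e]. }
  assert (Hgk : forall n t, 0 <= t <= 2 * PI -> ccont (fun t => g t * (z ^ n * e n t * ker r z t))%C t).
  { intros n t Ht. apply ccont_mult; [now apply Hg|].
    apply ccont_mult; [|now apply ccont_ker].
    apply ccont_mult; [apply ccont_const|apply ccont_e]. }
  assert (Hexp : forall n, cint (fun t => g t * ker r z t)%C 0 (2 * PI) =
    (Ci * cpoly (fun k => cint (fun t => g t * e k t)%C 0 (2 * PI)) n z +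
     cint (fun t => g t * (z ^ S n * e (S n) t * ker r z t))%C 0 (2 * PI))%C).
  { assert (Hst : forall n, cint (fun t => g t * (z ^ n * e n t * ker r z t))%C 0 (2 * PI) =
      (Ci * (cint (fun t => g t * e n t)%C 0 (2 * PI) * z ^ n) +
      cint (fun t => g t * (z ^ S n * e (S n) t * ker r z t))%C 0 (2 * PI))%C).
    { intros n.
      replace (Ci * (cint (fun t => g t * e n t)%C 0 (2 * PI) * z ^ n))%C with
        ((Ci * z ^ n) * cint (fun t => g t * e n t)%C 0 (2 * PI))%C by ring.
      rewrite <- cint_scal; [|lra|intros t Ht; now apply Hge].
      rewrite <- cint_plus; [|lra| |].
      - apply cint_ext; [lra|]. intros t _. rewrite ker_step. ring.
      - intros t Ht. apply ccont_mult; [apply ccont_const|now apply Hge].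
      - intros t Ht. now apply Hgk. }
    induction n as [|n IH].
    - rewrite cpoly_O.
      replace (Ci * cint (fun t => g t * e 0 t)%C 0 (2 * PI))%C with
        (Ci * (cint (fun t => g t * e 0 t)%C 0 (2 * PI) * z ^ 0))%C by (simpl; ring).
      rewrite <- Hst. apply cint_ext; [lra|]. intros t _. unfold e. simpl. ring.
    - rewrite IH, Hst, cpoly_S. ring. }
  intros eps He.
  set (K := r / (r - Cmod z)).
  assert (HK : 1 <= K).
  { unfold K. apply Rle_div_r; generalize (Cmod_ge_0 z); lra. }
  (* The added 1 keeps [A] positive even when the bound [B] of [g] is zero. *)
  set (A := 4 * PI * (B * K) + 1).
  assert (HA : 0 < A).
  { unfold A. assert (0 <= B * K) by (apply Rmult_le_pos; lra). nra. }
  assert (Hx : 0 <= Cmod z / r < 1).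
  { split; [apply Rle_div_r; generalize (Cmod_ge_0 z); lra|]. apply Rlt_div_l; lra. }
  destruct (pow_small (Cmod z / r) (eps / A)) as [N HN].
  { exact Hx. }
  { apply Rdiv_lt_0_compat; lra. }
  exists N. intros n Hn. rewrite (Hexp n).
  match goal with |- Cmod (?u + ?v - ?u) < _ => replace (u + v - u)%C with v by ring end.
  assert (HxS := HN (S n) ltac:(lia)).
  assert (Hx0 : 0 <= (Cmod z / r) ^ S n) by (apply pow_le; lra).
  eapply Rle_lt_trans.
  - apply (cint_bound _ _ _ (B * K * (Cmod z / r) ^ S n)); [lra|intros t Ht; now apply Hgk|].
    intros t Ht. rewrite !(Cmod_mult _ _), Cmod_e, Cmod_pow.
    replace (B * K * (Cmod z / r) ^ S n) with (B * ((Cmod z ^ S n * (/ r) ^ S n) * K)).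
    2: { rewrite <- Rpow_mult_distr. unfold Rdiv. ring. }
    apply Rmult_le_compat; [apply Cmod_ge_0| |now apply HB|].
    + apply Rmult_le_pos; [|apply Cmod_ge_0].
      rewrite <- Rpow_mult_distr. exact Hx0.
    + apply Rmult_le_compat_l; [|now apply ker_bound].
      rewrite <- Rpow_mult_distr. exact Hx0.
  - apply (Rmult_lt_compat_l A) in HxS; [|exact HA].
    replace (A * (eps / A)) with eps in HxS by (field; lra).
    eapply Rle_lt_trans; [|exact HxS].
    replace (2 * ((2 * PI - 0) * (B * K * (Cmod z / r) ^ S n)))
      with ((A - 1) * (Cmod z / r) ^ S n) by (unfold A; ring).
    lra.
Qed.

(** For [g = 1] only the term of index 0 of [ker_expand] survives, so the winding number is found
    without a logarithm. *)
Lemma cint_ker : cint (ker r z) 0 (2 * PI) = (Ci * RtoC (2 * PI))%C.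
Proof.
  assert (HPI := PI_RGT_0).
  apply eq_of_close. intros eps He.
  destruct (ker_expand (fun _ => RtoC 1)) with (eps := eps) as [N HN].
  { intros; apply ccont_const. }
  { exact He. }
  specialize (HN N (Nat.le_refl N)). left.
  replace (cint (ker r z) 0 (2 * PI)) with (cint (fun t => RtoC 1 * ker r z t)%C 0 (2 * PI)).
  2: { apply cint_ext; [lra|]. intros; ring. }
  replace (RtoC (2 * PI)) with
    (cpoly (fun k => cint (fun t => 1 * e k t)%C 0 (2 * PI)) N z); [exact HN|].
  clear HN. induction N as [|N IH].
  - rewrite cpoly_O. unfold cint, e; simpl.
    rewrite (RInt_ext _ (fun _ => 1)), RInt_const.
    2: { intros; rring. }
    rewrite (RInt_ext (fun t => _ + _) (fun _ => 0)), RInt_const.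
    2: { intros; rring. }
    unfold scal, RtoC; simpl; unfold mult; simpl. f_equal; rring.
  - rewrite cpoly_S, IH.
    replace (cint (fun t => 1 * e (S N) t)%C 0 (2 * PI)) with (RtoC 0); [ring|].
    unfold e. transitivity (RtoC (/ r) ^ S N * cint (fun t => cis (- t) ^ S N)%C 0 (2 * PI))%C.
    + rewrite cint_cis_pow. ring.
    + rewrite <- cint_scal; [|lra|].
      * apply cint_ext; [lra|]. intros; ring.
      * intros t _. apply (ccont_pow (fun t => cis (- t))).
        apply rderiv_ccont with (sin (- t), - cos (- t)).
        split; simpl; auto_derive; auto; ring.
Qed.
End Expansion.

(** The kernel is expanded in Cauchy's formula on the circle of radius [r]. At this stage the
    coefficients may depend on [r]. *)
Lemma taylor_circle f r : (forall w, Cmod w < 1 -> exists l, cderiv f w l) -> 0 < r < 1 ->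
  exists a, forall z, Cmod z < r -> @is_pseries C_AbsRing C_NormedModule a z (f z).
Proof.
  intros Hf Hr. assert (HPI := PI_RGT_0).
  set (b := fun k => cint (fun t => f (RtoC r * cis t) * (RtoC (/ r) ^ k * cis (- t) ^ k))%C 0 (2 * PI)).
  assert (H2 : RtoC (2 * PI) <> 0).
  { intros H. apply (f_equal fst) in H. simpl in H. lra. }
  exists (fun k => / RtoC (2 * PI) * b k)%C. intros z Hz.
  apply is_pseries_eps. intros eps He.
  destruct (ker_expand r z Hz (proj2 Hr) (fun t => f (RtoC r * cis t)%C)) with (eps := eps * (2 * PI)) as [N HN].
  { intros t _. destruct (Hf (RtoC r * cis t)%C) as [l Hl].
    { rewrite Cmod_rcis; lra. }
    apply ccont_comp with l; [exact Hl|]. apply ccont_mult; [apply ccont_const|apply ccont_cis]. }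
  { apply Rmult_lt_0_compat; lra. }
  exists N. intros n Hn. specialize (HN n Hn).
  rewrite (cauchy_kernel r z Hz (proj2 Hr) f Hf), (cint_ker r z Hz (proj2 Hr)) in HN.
  change (Cmod (f z * (Ci * RtoC (2 * PI)) - Ci * cpoly b n z) < eps * (2 * PI)) in HN.
  assert (E : cpoly (fun k => / RtoC (2 * PI) * b k)%C n z = (/ RtoC (2 * PI) * cpoly b n z)%C).
  { unfold cpoly. rewrite <- csum_scal. apply sum_n_ext. intros k. cring. }
  rewrite E.
  replace (/ RtoC (2 * PI) * cpoly b n z - f z)%C with
    (- (f z * (Ci * RtoC (2 * PI)) - Ci * cpoly b n z) / (Ci * RtoC (2 * PI)))%C.
  2: { field. split; [exact H2|]. intros H. apply (f_equal snd) in H. simpl in H. lra. }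
  rewrite Cmod_div, Cmod_opp, Cmod_mult, Cmod_Ci, Cmod_R, Rabs_pos_eq, Rmult_1_l; [|lra|].
  - apply Rlt_div_l; lra.
  - apply Cmult_neq_0; [|exact H2]. intros H. apply (f_equal snd) in H. simpl in H. lra.
Qed.

(** * Jets at the origin *)

(** Agreement up to [O(z^(M+1))] at the origin. It determines [a] up to index [M] and passes to
    products and composites, which is all that is needed to identify coefficients. *)
Definition jet (M : nat) (f : C -> C) (a : nat -> C) : Prop :=
  exists K r, 0 < r /\ forall z, Cmod z < r -> Cmod (f z - cpoly a M z) <= K * Cmod z ^ S M.

Lemma cpoly_0 a n : cpoly a n 0 = a 0%nat.
Proof.
  induction n as [|n IH]; [apply cpoly_O|]. rewrite cpoly_S, IH. simpl. ring.
Qed.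

Lemma cpoly_shift a n z : cpoly a (S n) z = (a 0%nat + z * cpoly (fun k => a (S k)) n z)%C.
Proof.
  unfold cpoly. rewrite csum_shift, <- csum_scal. simpl.
  rewrite Cmult_1_r. f_equal. apply sum_n_ext. intros; cring.
Qed.

Lemma cpoly_minus a b n z : cpoly (fun k => a k - b k)%C n z = (cpoly a n z - cpoly b n z)%C.
Proof.
  unfold cpoly. rewrite <- csum_minus. apply sum_n_ext. intros; cring.
Qed.

Lemma cpoly_bound a n z : Cmod z <= 1 -> Cmod (cpoly a n z) <= sum_n (fun k => Cmod (a k)) n.
Proof.
  intros Hz. eapply Rle_trans; [apply Cmod_csum|]. apply rsum_le. intros k _.
  rewrite Cmod_mult, Cmod_pow. rewrite <- (Rmult_1_r (Cmod (a k))) at 2.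
  apply Rmult_le_compat_l; [apply Cmod_ge_0|].
  rewrite <- (pow1 k). apply pow_incr. split; [apply Cmod_ge_0|exact Hz].
Qed.

Lemma cpoly_tail a n d z : Cmod z <= 1 ->
  Cmod (cpoly a (n + d) z - cpoly a n z) <= sum_n (fun k => Cmod (a k)) (n + d) * Cmod z ^ S n.
Proof.
  intros Hz. assert (H0 := Cmod_ge_0 z).
  assert (P : 0 <= Cmod z ^ S n) by now apply pow_le.
  induction d as [|d IH].
  - rewrite Nat.add_0_r. replace (cpoly a n z - cpoly a n z)%C with (RtoC 0) by ring.
    rewrite Cmod_0. apply Rmult_le_pos; [apply rsum_ge0; intros; apply Cmod_ge_0|exact P].
  - rewrite Nat.add_succ_r, cpoly_S, rsum_S.
    match goal with |- Cmod (?u + ?v - ?w) <= _ => replace (u + v - w)%C with ((u - w) + v)%C by ring end.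
    eapply Rle_trans; [apply Cmod_triangle|]. rewrite Rmult_plus_distr_r.
    apply Rplus_le_compat; [exact IH|].
    rewrite Cmod_mult, Cmod_pow. apply Rmult_le_compat_l; [apply Cmod_ge_0|].
    replace (S (n + d)) with (S n + d)%nat by lia. rewrite pow_add.
    rewrite <- (Rmult_1_r (Cmod z ^ S n)) at 2. apply Rmult_le_compat_l; [exact P|].
    rewrite <- (pow1 d). apply pow_incr. lra.
Qed.

(** The induction hypothesis serves twice: on [d] at degree [M], with the top term moved into the
    error, which gives [d 0 = 0]; then on the shifted coefficients, after division by [t]. *)
Lemma poly_small_zero M (d : nat -> C) K r : 0 < r ->
  (forall t, 0 < t < r -> Cmod (cpoly d M (RtoC t)) <= K * t ^ S M) ->
  forall k, (k <= M)%nat -> d k = 0.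
Proof.
  revert d K r. induction M as [|M IH]; intros d K r Hr H.
  - intros k Hk. replace k with 0%nat by lia.
    apply eq_of_close. intros eps He.
    replace (d 0%nat - 0)%C with (d 0%nat) by ring.
    set (t := Rmin (r / 2) (eps / (1 + Rabs K))).
    assert (HK := Rabs_pos K).
    assert (Ht : 0 < t < r).
    { split; [apply Rmin_glb_lt; [lra|apply Rdiv_lt_0_compat; lra]|].
      eapply Rle_lt_trans; [apply Rmin_l|lra]. }
    specialize (H t Ht). rewrite cpoly_O in H. eapply Rle_trans; [exact H|].
    simpl. rewrite Rmult_1_r.
    assert (Ht2 : t * (1 + Rabs K) <= eps).
    { apply Rle_div_r; [lra|apply Rmin_r]. }
    generalize (Rle_abs K). nra.
  - assert (D0 : d 0%nat = 0).
    { apply (IH d (K * r + sum_n (fun k => Cmod (d k)) (S M)) (Rmin r 1)).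
      3: lia. { apply Rmin_glb_lt; lra. }
      intros t Ht.
      assert (Ht1 := Rlt_le_trans _ _ _ (proj2 Ht) (Rmin_l _ _)).
      assert (Ht2 := Rlt_le_trans _ _ _ (proj2 Ht) (Rmin_r _ _)).
      specialize (H t ltac:(lra)).
      assert (HtC : Cmod (RtoC t) = t) by (rewrite Cmod_R, Rabs_pos_eq; lra).
      assert (Tl := cpoly_tail d M 1 (RtoC t) ltac:(lra)).
      rewrite Nat.add_1_r, HtC in Tl.
      assert (P : 0 < t ^ S M) by (apply pow_lt; lra).
      replace (cpoly d M (RtoC t)) with (cpoly d (S M) (RtoC t) - (cpoly d (S M) (RtoC t) - cpoly d M (RtoC t)))%C by ring.
      eapply Rle_trans; [apply Cmod_minus_le|].
      rewrite Rmult_plus_distr_r. apply Rplus_le_compat; [|exact Tl].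
      eapply Rle_trans; [exact H|].
      assert (HK : 0 <= K).
      { assert (0 <= K * t ^ S (S M)) by (eapply Rle_trans; [apply Cmod_ge_0|exact H]).
        assert (0 < t ^ S (S M)) by (apply pow_lt; lra).
        destruct (Rle_lt_dec 0 K) as [Q|Q]; [exact Q|]. exfalso. nra. }
      change (t ^ S (S M)) with (t * t ^ S M).
      rewrite Rmult_assoc. apply Rmult_le_compat_l; [exact HK|].
      apply Rmult_le_compat_r; lra. }
    intros [|k] Hk; [exact D0|].
    apply (IH (fun k => d (S k)) K r Hr); [|lia].
    intros t Ht. specialize (H t Ht). rewrite cpoly_shift, D0, Cplus_0_l in H.
    rewrite Cmod_mult, Cmod_R, Rabs_pos_eq in H by lra.
    apply Rmult_le_reg_l with t; [lra|]. eapply Rle_trans; [exact H|]. simpl. lra.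
Qed.

Lemma jet_unique M f a b : jet M f a -> jet M f b -> forall k, (k <= M)%nat -> a k = b k.
Proof.
  intros (K1 & r1 & Hr1 & H1) (K2 & r2 & Hr2 & H2) k Hk.
  enough (E : (a k - b k)%C = 0).
  { replace (a k) with (a k - b k + b k)%C by ring. rewrite E. ring. }
  apply (poly_small_zero M (fun k => a k - b k)%C (K1 + K2) (Rmin r1 r2)); [|intros t Ht|exact Hk].
  { now apply Rmin_glb_lt. }
  assert (HtC : Cmod (RtoC t) = t) by (rewrite Cmod_R, Rabs_pos_eq; lra).
  assert (Ht1 := Rlt_le_trans _ _ _ (proj2 Ht) (Rmin_l _ _)).
  assert (Ht2 := Rlt_le_trans _ _ _ (proj2 Ht) (Rmin_r _ _)).
  specialize (H1 (RtoC t) ltac:(lra)). specialize (H2 (RtoC t) ltac:(lra)).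
  rewrite HtC in H1, H2. rewrite cpoly_minus.
  replace (cpoly a M t - cpoly b M t)%C with
    ((f (RtoC t) - cpoly b M t) - (f (RtoC t) - cpoly a M t))%C by ring.
  eapply Rle_trans; [apply Cmod_minus_le|]. lra.
Qed.

(** * Tails of power series and existence of the Taylor series *)

Lemma geom_tail a z B x : 0 <= x < 1 -> (forall k, Cmod (a k * z ^ k) <= B * x ^ k) ->
  forall n m, (n <= m)%nat -> Cmod (cpoly a m z - cpoly a n z) <= B / (1 - x) * x ^ S n.
Proof.
  intros Hx H n m Hnm.
  assert (HB : 0 <= B).
  { specialize (H 0%nat). simpl in H. rewrite Rmult_1_r in H.
    eapply Rle_trans; [apply Cmod_ge_0|exact H]. }
  (* The sharper bound telescopes, so it can be proved by induction on [m]. *)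
  apply Rle_trans with (B / (1 - x) * (x ^ S n - x ^ S m)).
  - induction Hnm as [|m Hnm IH].
    + replace (cpoly a n z - cpoly a n z)%C with (RtoC 0) by ring. rewrite Cmod_0. lra.
    + rewrite cpoly_S.
      match goal with |- Cmod (?u + ?v - ?w) <= _ => replace (u + v - w)%C with ((u - w) + v)%C by ring end.
      eapply Rle_trans; [apply Cmod_triangle|].
      eapply Rle_trans; [apply Rplus_le_compat; [exact IH|apply H]|].
      right. simpl. field. lra.
  - apply Rmult_le_compat_l.
    + apply Rmult_le_pos; [exact HB|]. left; apply Rinv_0_lt_compat; lra.
    + assert (0 <= x ^ S m) by (apply pow_le; lra). lra.
Qed.

Lemma pseries_coef_bound a z l : @is_pseries C_AbsRing C_NormedModule a z l ->
  exists B, 0 <= B /\ forall k, Cmod (a k) * Cmod z ^ k <= B.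
Proof.
  intros H. destruct (proj1 (is_pseries_eps a z l) H 1 Rlt_0_1) as [N HN].
  set (S0 := sum_n (fun k => Cmod (a k) * Cmod z ^ k) N).
  assert (Hpos : forall k, 0 <= Cmod (a k) * Cmod z ^ k).
  { intros k; apply Rmult_le_pos; [apply Cmod_ge_0|apply pow_le, Cmod_ge_0]. }
  assert (HS : 0 <= S0) by (apply rsum_ge0; auto).
  exists (S0 + 2). split; [lra|]. intros k. destruct (Nat.le_gt_cases k N) as [Hk|Hk].
  - assert (T := rsum_term _ N k Hpos Hk). fold S0 in T. simpl in T. lra.
  - destruct k as [|k]; [lia|].
    rewrite <- Cmod_pow, <- Cmod_mult.
    replace (a (S k) * z ^ S k)%C with ((cpoly a (S k) z - l) - (cpoly a k z - l))%C
      by (rewrite cpoly_S; ring).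
    eapply Rle_trans; [apply Cmod_minus_le|].
    assert (H1 := HN (S k) ltac:(lia)). assert (H2 := HN k ltac:(lia)). lra.
Qed.

(** Convergence at [s] bounds [|a_k| s^k] by [B], and the tail is compared with a geometric series.
    The same [B] serves all [z] and [n], which gives uniformity on circles. *)
Lemma pseries_tail a s l : @is_pseries C_AbsRing C_NormedModule a (RtoC s) l -> 0 < s ->
  exists B, 0 <= B /\ forall z v, Cmod z < s -> @is_pseries C_AbsRing C_NormedModule a z v ->
    forall n, Cmod (v - cpoly a n z) <= B / (1 - Cmod z / s) * (Cmod z / s) ^ S n.
Proof.
  intros H Hs. destruct (pseries_coef_bound _ _ _ H) as [B [HB0 HB]].
  rewrite Cmod_R, Rabs_pos_eq in HB by lra.
  exists B. split; [exact HB0|]. intros z v Hz Hv n.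
  assert (Hx : 0 <= Cmod z / s < 1).
  { split; [apply Rle_div_r; generalize (Cmod_ge_0 z); lra|]. apply Rlt_div_l; lra. }
  assert (G := geom_tail a z B (Cmod z / s) Hx).
  assert (G' : forall k, Cmod (a k * z ^ k) <= B * (Cmod z / s) ^ k).
  { intros k. rewrite Cmod_mult, Cmod_pow.
    replace (Cmod (a k) * Cmod z ^ k) with (Cmod (a k) * s ^ k * (Cmod z / s) ^ k).
    - apply Rmult_le_compat_r; [apply pow_le; lra|apply HB].
    - rewrite Rmult_assoc, <- Rpow_mult_distr. do 2 f_equal. field. lra. }
  specialize (G G'). apply le_epsilon. intros eps He.
  destruct (proj1 (is_pseries_eps a z v) Hv eps He) as [N HN].
  specialize (HN (max n N) ltac:(lia)). specialize (G n (max n N) ltac:(lia)).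
  replace (v - cpoly a n z)%C with
    ((cpoly a (max n N) z - cpoly a n z) - (cpoly a (max n N) z - v))%C by ring.
  eapply Rle_trans; [apply Cmod_minus_le|]. lra.
Qed.

Lemma pseries_jet M f a s : 0 < s ->
  (forall z, Cmod z <= s -> @is_pseries C_AbsRing C_NormedModule a z (f z)) -> jet M f a.
Proof.
  intros Hs H.
  destruct (pseries_tail a s (f (RtoC s))) as [B [HB0 HB]].
  { apply H. rewrite Cmod_R, Rabs_pos_eq; lra. }
  { exact Hs. }
  exists (B / (1 / 2) * (/ s) ^ S M), (s / 2). split; [lra|]. intros z Hz.
  specialize (HB z (f z) ltac:(lra) (H z ltac:(lra)) M).
  eapply Rle_trans; [exact HB|]. unfold Rdiv at 3. rewrite Rpow_mult_distr.
  assert (Hx : Cmod z / s <= 1 / 2).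
  { apply Rle_div_l; lra. }
  assert (P1 : 0 <= Cmod z ^ S M) by (apply pow_le, Cmod_ge_0).
  assert (P2 : 0 <= (/ s) ^ S M) by (apply pow_le; left; now apply Rinv_0_lt_compat).
  assert (Q : B / (1 - Cmod z / s) <= B / (1 / 2)).
  { apply Rmult_le_compat_l; [exact HB0|]. apply Rinv_le_contravar; lra. }
  replace (B / (1 / 2) * (/ s) ^ S M * Cmod z ^ S M) with
    (B / (1 / 2) * (Cmod z ^ S M * (/ s) ^ S M)) by ring.
  apply Rmult_le_compat_r; [|exact Q]. now apply Rmult_le_pos.
Qed.

(** The coefficients are fixed at radius [1 / 2]. A point further out uses a larger circle, whose
    coefficients are the same because both sequences are jets of [f] at the origin. *)
Lemma taylor_disk f : (forall w, Cmod w < 1 -> exists l, cderiv f w l) ->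
  exists a, power_series_on_disk a f.
Proof.
  intros Hf. destruct (taylor_circle f (1 / 2) Hf ltac:(lra)) as [a Ha].
  exists a. intros z Hz. unfold in_disk in Hz.
  set (r := Rmax (1 / 2) ((1 + Cmod z) / 2)).
  assert (Hr : 1 / 2 <= r < 1).
  { split; [apply Rmax_l|]. apply Rmax_lub_lt; lra. }
  assert (Hzr : Cmod z < r).
  { eapply Rlt_le_trans; [|apply Rmax_r]. lra. }
  destruct (taylor_circle f r Hf ltac:(lra)) as [b Hb].
  assert (E : forall k, b k = a k).
  { intros k. apply (jet_unique k f b a); [| |lia]; apply (pseries_jet k f _ (1 / 4)); try lra;
    intros w Hw; [apply Hb|apply Ha]; lra. }
  apply is_pseries_eps. intros eps He.
  destruct (proj1 (is_pseries_eps b z (f z)) (Hb z Hzr) eps He) as [N HN].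
  exists N. intros n Hn. specialize (HN n Hn).
  replace (cpoly a n z) with (cpoly b n z); [exact HN|].
  apply sum_n_ext. intros k. now rewrite E.
Qed.

Lemma jet_bounded M f a : jet M f a ->
  exists K r, 0 < r /\ 0 <= K /\ forall z, Cmod z < r -> Cmod (f z) <= K.
Proof.
  intros (K & r & Hr & H).
  exists (Rabs K + sum_n (fun k => Cmod (a k)) M), (Rmin r 1).
  split; [apply Rmin_glb_lt; lra|]. split.
  { apply Rplus_le_le_0_compat; [apply Rabs_pos|]. apply rsum_ge0; intros; apply Cmod_ge_0. }
  intros z Hz.
  assert (H1 := Rlt_le_trans _ _ _ Hz (Rmin_l _ _)).
  assert (H2 := Rlt_le_trans _ _ _ Hz (Rmin_r _ _)).
  replace (f z) with ((f z - cpoly a M z) + cpoly a M z)%C by ring.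
  eapply Rle_trans; [apply Cmod_triangle|].
  apply Rplus_le_compat; [|apply cpoly_bound; lra].
  eapply Rle_trans; [now apply H|].
  assert (P : 0 <= Cmod z ^ S M <= 1).
  { split; [apply pow_le, Cmod_ge_0|]. rewrite <- (pow1 (S M)). apply pow_incr.
    split; [apply Cmod_ge_0|lra]. }
  generalize (Rle_abs K) (Rabs_pos K). nra.
Qed.

(** The error has three parts: that of [f], that of [g], and the terms of degree above [M] in the
    product of the two truncations, bounded through [conv_poly] and [cpoly_tail]. *)
Lemma jet_mult M f g a b : jet M f a -> jet M g b -> jet M (fun z => f z * g z)%C (conv a b).
Proof.
  intros Hf Hg.
  destruct (jet_bounded _ _ _ Hg) as (K3 & r3 & Hr3 & HK3 & H3).
  destruct Hf as (K1 & r1 & Hr1 & H1), Hg as (K2 & r2 & Hr2 & H2).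
  set (r := Rmin (Rmin r1 r2) (Rmin r3 1)).
  set (SA := sum_n (fun k => Cmod (a k)) M).
  set (SB := sum_n (fun k => Cmod (b k)) M).
  exists (K1 * K3 + SA * K2 + SA * SB), r.
  split; [repeat apply Rmin_glb_lt; lra|]. intros z Hz.
  assert (Z1 : Cmod z < r1) by (eapply Rlt_le_trans; [exact Hz|]; eapply Rle_trans; apply Rmin_l).
  assert (Z2 : Cmod z < r2).
  { eapply Rlt_le_trans; [exact Hz|]; eapply Rle_trans; [apply Rmin_l|apply Rmin_r]. }
  assert (Z3 : Cmod z < r3).
  { eapply Rlt_le_trans; [exact Hz|]; eapply Rle_trans; [apply Rmin_r|apply Rmin_l]. }
  assert (Z4 : Cmod z < 1) by (eapply Rlt_le_trans; [exact Hz|]; eapply Rle_trans; apply Rmin_r).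
  replace (f z * g z - cpoly (conv a b) M z)%C with
    ((f z - cpoly a M z) * g z + cpoly a M z * (g z - cpoly b M z) +
     (cpoly a M z * cpoly b M z - cpoly (conv a b) M z))%C by ring.
  assert (P : 0 <= Cmod z ^ S M) by (apply pow_le, Cmod_ge_0).
  assert (PA := cpoly_bound a M z ltac:(lra)). fold SA in PA.
  eapply Rle_trans; [apply Cmod_triangle|]. rewrite 2!Rmult_plus_distr_r.
  apply Rplus_le_compat; [eapply Rle_trans; [apply Cmod_triangle|]; apply Rplus_le_compat|].
  - rewrite Cmod_mult. replace (K1 * K3 * Cmod z ^ S M) with (K1 * Cmod z ^ S M * K3) by ring.
    apply Rmult_le_compat; try apply Cmod_ge_0; auto.
  - rewrite Cmod_mult, Rmult_assoc. apply Rmult_le_compat; try apply Cmod_ge_0; auto.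
  - rewrite conv_poly. unfold cpoly at 1. rewrite Cmult_comm, <- csum_scal, <- csum_minus.
    eapply Rle_trans; [apply Cmod_csum|].
    replace (SA * SB * Cmod z ^ S M) with ((SB * Cmod z ^ S M) * SA) by ring.
    unfold SA. rewrite <- rsum_scal. apply rsum_le. intros i Hi.
    replace (cpoly b M z * (a i * z ^ i) - a i * z ^ i * cpoly b (M - i) z)%C with
      (a i * (z ^ i * (cpoly b M z - cpoly b (M - i) z)))%C by ring.
    rewrite !Cmod_mult, Rmult_comm. apply Rmult_le_compat_r; [apply Cmod_ge_0|].
    assert (T := cpoly_tail b (M - i) i z ltac:(lra)).
    replace (M - i + i)%nat with M in T by lia. fold SB in T.
    rewrite Cmod_pow.
    apply Rle_trans with (Cmod z ^ i * (SB * Cmod z ^ S (M - i))).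
    + apply Rmult_le_compat_l; [apply pow_le, Cmod_ge_0|exact T].
    + right. replace (S M) with (i + S (M - i))%nat by lia. rewrite pow_add. ring.
Qed.

Lemma jet_pow M f c n : jet M f c -> jet M (fun z => f z ^ n)%C (cpow c n).
Proof.
  intros H. induction n as [|n IH].
  - exists 0, 1. split; [lra|]. intros z _.
    replace (cpoly (cpow c 0) M z) with (RtoC 1).
    + replace (f z ^ 0 - 1)%C with (RtoC 0) by (simpl; ring). rewrite Cmod_0. lra.
    + clear H. induction M as [|m IHm]; [now rewrite cpoly_O|].
      rewrite cpoly_S. simpl (cpow c 0 (S m)). rewrite Cmult_0_l, Cplus_0_r. exact IHm.
  - exact (jet_mult M f (fun z => f z ^ n)%C c (cpow c n) H IH).
Qed.

(** As [c 0 = 0], one has [|phi z| <= L |z|] near [0]. An error [O(w^(M+1))] in [f] thus stays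
    [O(z^(M+1))] at [w = phi z], and powers of [phi] beyond [M] are invisible at this order. *)
Lemma jet_comp M f phi (a c : nat -> C) : jet M f a -> jet M phi c -> c 0%nat = 0 ->
  jet M (fun z => f (phi z)) (fun m => sum_n (fun n => a n * cpow c n m)%C M).
Proof.
  intros (K1 & r1 & Hr1 & H1) Hphi Hc.
  assert (Hlin : exists L r, 0 < r /\ 0 < L /\ forall z, Cmod z < r -> Cmod (phi z) <= L * Cmod z).
  { destruct Hphi as (K & r & Hr & H).
    exists (Rabs K + sum_n (fun k => Cmod (c k)) M + 1), (Rmin r 1).
    assert (HS : 0 <= sum_n (fun k => Cmod (c k)) M) by (apply rsum_ge0; intros; apply Cmod_ge_0).
    assert (HK := Rabs_pos K).
    split; [apply Rmin_glb_lt; lra|]. split; [lra|]. intros z Hz.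
    assert (Z1 := Rlt_le_trans _ _ _ Hz (Rmin_l _ _)).
    assert (Z2 := Rlt_le_trans _ _ _ Hz (Rmin_r _ _)).
    assert (T := cpoly_tail c 0 M z ltac:(lra)).
    rewrite cpoly_O, Hc, Nat.add_0_l in T.
    replace (phi z) with ((phi z - cpoly c M z) + (cpoly c M z - 0))%C by ring.
    eapply Rle_trans; [apply Cmod_triangle|]. rewrite pow_1 in T.
    specialize (H z Z1). assert (H0 := Cmod_ge_0 z).
    assert (P : 0 <= Cmod z ^ S M <= Cmod z).
    { split; [now apply pow_le|]. simpl. rewrite <- (Rmult_1_r (Cmod z)) at 3.
      apply Rmult_le_compat_l; [exact H0|]. rewrite <- (pow1 M). apply pow_incr. lra. }
    generalize (Rle_abs K). nra. }
  destruct Hlin as (L & r & Hr & HL & Hlin).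
  assert (Hsum : forall n, jet M (fun z => sum_n (fun k => a k * phi z ^ k)%C n)
    (fun m => sum_n (fun k => a k * cpow c k m)%C n)).
  { assert (Hone : forall k, jet M (fun z => a k * phi z ^ k)%C (fun m => a k * cpow c k m)%C).
    { intros k. destruct (jet_pow M phi c k Hphi) as (K & s & Hs & H).
      exists (Cmod (a k) * K), s. split; [exact Hs|]. intros z Hz.
      replace (cpoly (fun m => a k * cpow c k m)%C M z) with (a k * cpoly (cpow c k) M z)%C.
      - replace (a k * phi z ^ k - a k * cpoly (cpow c k) M z)%C with
          (a k * (phi z ^ k - cpoly (cpow c k) M z))%C by ring.
        rewrite Cmod_mult, Rmult_assoc. apply Rmult_le_compat_l; [apply Cmod_ge_0|auto].
      - unfold cpoly. rewrite <- csum_scal. apply sum_n_ext. intros; cring. }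
    induction n as [|n IH].
    - destruct (Hone 0%nat) as (K & s & Hs & H). exists K, s. split; [exact Hs|].
      intros z Hz. specialize (H z Hz). rewrite csum_O.
      replace (cpoly (fun m => sum_n (fun k => a k * cpow c k m)%C 0) M z) with
        (cpoly (fun m => a 0%nat * cpow c 0 m)%C M z); [exact H|].
      apply sum_n_ext. intros m. now rewrite csum_O.
    - destruct IH as (K & s & Hs & H), (Hone (S n)) as (K' & s' & Hs' & H').
      exists (K + K'), (Rmin s s'). split; [now apply Rmin_glb_lt|]. intros z Hz.
      specialize (H z (Rlt_le_trans _ _ _ Hz (Rmin_l _ _))).
      specialize (H' z (Rlt_le_trans _ _ _ Hz (Rmin_r _ _))).
      rewrite csum_S.
      replace (cpoly (fun m => sum_n (fun k => a k * cpow c k m)%C (S n)) M z) with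
        (cpoly (fun m => sum_n (fun k => a k * cpow c k m)%C n) M z +
         cpoly (fun m => a (S n) * cpow c (S n) m)%C M z)%C.
      + match goal with |- Cmod (?x + ?y - (?u + ?v)) <= _ =>
          replace (x + y - (u + v))%C with ((x - u) + (y - v))%C by ring end.
        eapply Rle_trans; [apply Cmod_triangle|]. rewrite Rmult_plus_distr_r.
        now apply Rplus_le_compat.
      + unfold cpoly. rewrite <- csum_plus. apply sum_n_ext. intros m. rewrite csum_S. cring. }
  destruct (Hsum M) as (K2 & r2 & Hr2 & H2).
  exists (Rabs K1 * L ^ S M + K2), (Rmin (Rmin r r2) (r1 / L)).
  assert (HrL : 0 < r1 / L) by now apply Rdiv_lt_0_compat.
  split; [repeat apply Rmin_glb_lt; lra|]. intros z Hz.
  assert (Z3 := Rlt_le_trans _ _ _ Hz (Rmin_r _ _)).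
  assert (Z0 := Rlt_le_trans _ _ _ Hz (Rmin_l _ _)).
  assert (Z1 := Rlt_le_trans _ _ _ Z0 (Rmin_l _ _)).
  assert (Z2 := Rlt_le_trans _ _ _ Z0 (Rmin_r _ _)).
  specialize (Hlin z Z1). specialize (H2 z Z2).
  assert (Z4 : Cmod (phi z) < r1).
  { eapply Rle_lt_trans; [exact Hlin|]. apply (Rmult_lt_compat_l L) in Z3; [|exact HL].
    replace (L * (r1 / L)) with r1 in Z3 by (field; lra). exact Z3. }
  specialize (H1 _ Z4).
  match goal with |- Cmod (?x - ?y) <= _ =>
    replace (x - y)%C with ((x - cpoly a M (phi z)) + (cpoly a M (phi z) - y))%C by ring end.
  eapply Rle_trans; [apply Cmod_triangle|]. rewrite Rmult_plus_distr_r.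
  apply Rplus_le_compat; [|exact H2].
  eapply Rle_trans; [exact H1|].
  apply Rle_trans with (Rabs K1 * Cmod (phi z) ^ S M).
  - apply Rmult_le_compat_r; [apply pow_le, Cmod_ge_0|apply Rle_abs].
  - rewrite Rmult_assoc, <- Rpow_mult_distr. apply Rmult_le_compat_l; [apply Rabs_pos|].
    apply pow_incr. split; [apply Cmod_ge_0|exact Hlin].
Qed.

(** * Parseval's identity and Littlewood's subordination principle *)

Lemma cis_plus a b : cis (a + b) = (cis a * cis b)%C.
Proof.
  unfold cis, Cmult; simpl. rewrite cos_plus, sin_plus. f_equal. ring.
Qed.

Lemma cis_0 : cis 0 = 1.
Proof. unfold cis. now rewrite cos_0, sin_0. Qed.

Lemma cis_pow t n : (cis t ^ n)%C = cis (INR n * t).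
Proof.
  induction n as [|n IH].
  - simpl. now rewrite Rmult_0_l, cis_0.
  - rewrite Cpow_S, IH, S_INR, <- cis_plus. f_equal. ring.
Qed.

Lemma cis_conj t : Cconj (cis t) = cis (- t).
Proof. unfold cis, Cconj; simpl. now rewrite cos_neg, sin_neg. Qed.

Lemma cis_2PI_nat n : cis (INR n * (2 * PI)) = 1.
Proof.
  rewrite <- cis_pow. replace (cis (2 * PI)) with (cis 0).
  - rewrite cis_0. apply Cpow_1_l.
  - rewrite <- (cis_period 0). f_equal. ring.
Qed.

Lemma cis_neq1 a : 0 < Rabs a < 2 * PI -> cis a <> 1.
Proof.
  intros Ha H. apply (f_equal fst) in H. simpl in H.
  replace a with (2 * (a / 2)) in H by field. rewrite cos_2a_sin in H.
  assert (Hs : sin (a / 2) = 0) by nra.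
  destruct (Rle_dec 0 a) as [P|P].
  - rewrite Rabs_pos_eq in Ha by lra. assert (0 < sin (a / 2)) by (apply sin_gt_0; lra). lra.
  - rewrite Rabs_left in Ha by lra.
    assert (0 < sin (- (a / 2))) by (apply sin_gt_0; lra). rewrite sin_neg in *. lra.
Qed.

Lemma csum_geom (y : C) n : ((1 - y) * sum_n (fun j => y ^ j)%C n)%C = (1 - y ^ S n)%C.
Proof.
  induction n as [|n IH]; [rewrite csum_O; simpl; ring|].
  rewrite csum_S, Cmult_plus_distr_l, IH. simpl. ring.
Qed.

(** Discrete orthogonality: [|k - l| < D + 1] ensures that for [k <> l] the ratio of the geometric
    sum is a root of unity other than 1. *)
Lemma root_of_unity_sum D k l : (k <= D)%nat -> (l <= D)%nat ->
  sum_n (fun j => cis (2 * PI * (INR k - INR l) / INR (S D)) ^ j)%C D =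
  if Nat.eqb l k then RtoC (INR (S D)) else RtoC 0.
Proof.
  intros Hk Hl. assert (HN : 0 < INR (S D)) by (apply lt_0_INR; lia).
  assert (HPI := PI_RGT_0).
  destruct (Nat.eqb_spec l k) as [->|Hne].
  - replace (2 * PI * (INR k - INR k) / INR (S D)) with 0 by (field; lra).
    rewrite cis_0. clear. induction D as [|D IH].
    + rewrite csum_O. reflexivity.
    + rewrite csum_S, IH, Cpow_1_l, (S_INR (S D)), RtoC_plus. reflexivity.
  - set (a := 2 * PI * (INR k - INR l) / INR (S D)).
    assert (E := csum_geom (cis a) D).
    assert (E1 : (cis a ^ S D)%C = 1).
    { rewrite cis_pow. replace (INR (S D) * a) with (INR k * (2 * PI) + - (INR l * (2 * PI)))
        by (unfold a; field; lra).
      rewrite cis_plus, <- cis_conj, !cis_2PI_nat.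
      apply injective_projections; simpl; ring. }
    rewrite E1 in E. replace (1 - 1)%C with (RtoC 0) in E by ring.
    assert (Hn1 : (1 - cis a)%C <> 0).
    { intros H. apply (cis_neq1 a).
      - assert (Hkl : 0 < Rabs (INR k - INR l) < INR (S D)).
        { split.
          - apply Rabs_pos_lt. intros H'. apply Hne, INR_eq. lra.
          - apply le_INR in Hk, Hl. rewrite S_INR. apply Rabs_def1;
            generalize (pos_INR k) (pos_INR l); lra. }
        unfold a, Rdiv. rewrite !Rabs_mult, (Rabs_pos_eq 2), (Rabs_pos_eq PI), (Rabs_pos_eq (/ _)); try lra.
        + split.
          * apply Rmult_lt_0_compat; [|now apply Rinv_0_lt_compat].
            apply Rmult_lt_0_compat; [lra|apply Hkl].
          * apply (Rlt_div_l _ _ (INR (S D))); [exact HN|]. apply Rmult_lt_compat_l; lra.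
        + left; now apply Rinv_0_lt_compat.
      - replace (cis a) with (1 - (1 - cis a))%C by ring. rewrite H. ring. }
    apply Cmod_eq_0.
    apply (f_equal Cmod) in E. rewrite Cmod_mult, Cmod_0 in E.
    apply Cmod_gt_0 in Hn1.
    apply Rmult_integral in E. destruct E as [E|E]; [lra|exact E].
Qed.

Lemma csum_delta (v : nat -> C) k n : (k <= n)%nat ->
  sum_n (fun l => if Nat.eqb l k then v l else RtoC 0) n = v k.
Proof.
  intros Hk. induction n as [|n IH].
  - rewrite csum_O. replace k with 0%nat by lia. reflexivity.
  - rewrite csum_S. destruct (Nat.eqb_spec (S n) k) as [<-|Hne].
    + rewrite csum_zero; [cring|]. intros l Hl. destruct (Nat.eqb_spec l (S n)); [lia|reflexivity].
    + rewrite IH by lia. cring.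
Qed.

Lemma Cconj_csum (a : nat -> C) n : Cconj (sum_n a n) = sum_n (fun k => Cconj (a k)) n.
Proof.
  induction n as [|n IH]; [now rewrite !csum_O|].
  rewrite !csum_S, <- IH. apply Cplus_conj.
Qed.

Lemma RtoC_rsum (a : nat -> R) n : RtoC (sum_n a n) = sum_n (fun k => RtoC (a k)) n.
Proof.
  induction n as [|n IH]; [now rewrite rsum_O, csum_O|].
  rewrite rsum_S, csum_S, <- IH. apply RtoC_plus.
Qed.

(** Parseval's identity with the circle replaced by [D + 1] equally spaced points; it is exact
    because the degree is at most [D]. *)
Lemma parseval (h : nat -> C) D r : 0 <= r ->
  sum_n (fun j => Cmod (cpoly h D (RtoC r * cis (2 * PI * INR j / INR (S D)))) ^ 2) D =
  INR (S D) * sum_n (fun k => Cmod (h k) ^ 2 * r ^ (2 * k)) D.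
Proof.
  intros Hr. apply RtoC_inj. rewrite RtoC_rsum, RtoC_mult, RtoC_rsum.
  assert (HN : 0 < INR (S D)) by (apply lt_0_INR; lia).
  set (u := fun k => (h k * RtoC r ^ k)%C).
  set (x := fun j => cis (2 * PI * INR j / INR (S D))).
  transitivity (sum_n (fun j => sum_n (fun k => sum_n (fun l =>
     u k * Cconj (u l) * (cis (2 * PI * (INR k - INR l) / INR (S D)) ^ j))%C D) D) D).
  { apply sum_n_ext. intros j. rewrite Cmod2_conj.
    assert (E : cpoly h D (RtoC r * cis (2 * PI * INR j / INR (S D))) = sum_n (fun k => u k * x j ^ k)%C D).
    { apply sum_n_ext. intros k. unfold u, x. rewrite Cpow_mult_l. cring. }
    rewrite E, Cconj_csum. rewrite Cmult_comm, <- csum_scal. apply sum_n_ext. intros k.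
    rewrite Cmult_comm, <- csum_scal. apply sum_n_ext. intros l.
    rewrite Cmult_conj, Cpow_conj. unfold x at 2. rewrite cis_conj. unfold x.
    rewrite !cis_pow.
    replace (INR j * (2 * PI * (INR k - INR l) / INR (S D))) with
      (INR k * (2 * PI * INR j / INR (S D)) + INR l * - (2 * PI * INR j / INR (S D)))
      by (field; lra).
    rewrite cis_plus. cring. }
  rewrite sum_n_switch, <- csum_scal. apply sum_n_ext_loc. intros k Hk.
  rewrite sum_n_switch.
  transitivity (sum_n (fun l => if Nat.eqb l k then (u k * Cconj (u l) * RtoC (INR (S D)))%C else RtoC 0) D).
  { apply sum_n_ext_loc. intros l Hl. rewrite csum_scal, root_of_unity_sum by assumption.
    destruct (Nat.eqb l k); cring. }
  rewrite (csum_delta (fun l => (u k * Cconj (u l) * RtoC (INR (S D)))%C)) by assumption.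
  rewrite <- Cmod2_conj. unfold u. rewrite Cmod_mult, Cmod_pow, Cmod_R, Rabs_pos_eq by exact Hr.
  rewrite Rpow_mult_distr, <- pow_mult, (Nat.mul_comm k 2).
  rewrite Cmult_comm. reflexivity.
Qed.

(** * Multiplication by a self-map of the disk *)

Definition trunc (M : nat) (g : nat -> C) (k : nat) : C := if Nat.leb k M then g k else RtoC 0.

Lemma trunc_low M g k : (k <= M)%nat -> trunc M g k = g k.
Proof. intros H. unfold trunc. now rewrite (proj2 (Nat.leb_le k M) H). Qed.

Lemma trunc_high M g k : (M < k)%nat -> trunc M g k = 0.
Proof. intros H. unfold trunc. now rewrite (proj2 (Nat.leb_gt k M) H). Qed.

Lemma cpoly_trunc M g n z : (M <= n)%nat -> cpoly (trunc M g) n z = cpoly g M z.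
Proof.
  intros H. induction H as [|n H IH].
  - apply sum_n_ext_loc. intros k Hk. now rewrite trunc_low.
  - rewrite cpoly_S, IH, trunc_high by lia. ring.
Qed.

Lemma cpoly_conv_trunc c g L M z :
  cpoly (conv (trunc L c) (trunc M g)) (L + M) z = (cpoly c L z * cpoly g M z)%C.
Proof.
  rewrite conv_poly, <- (cpoly_trunc L c (L + M) z) by lia.
  rewrite Cmult_comm. unfold cpoly at 3. rewrite <- csum_scal.
  apply sum_n_ext_loc. intros i Hi. destruct (Nat.le_gt_cases i L) as [H|H].
  - rewrite cpoly_trunc by lia. cring.
  - rewrite trunc_high by lia. cring.
Qed.

Lemma bernoulli_le d n : 0 <= d <= 1 -> 1 - INR n * d <= (1 - d) ^ n.
Proof.
  intros Hd. induction n as [|n IH]; [simpl; lra|].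
  rewrite S_INR. simpl.
  assert (H : 0 <= INR n * d) by (apply Rmult_le_pos; [apply pos_INR|lra]).
  assert (H2 : 0 <= (1 - d) ^ n) by (apply pow_le; lra).
  nra.
Qed.

(** On a circle of radius [r < 1] a long partial sum of [phi] has modulus at most [1 + eta].
    Parseval for the product and for [g] compares the coefficients, up to powers of [r]; then [r]
    tends to 1 and [eta] to 0. *)
Lemma multiplier_contraction phi (c : nat -> C) :
  (forall z, Cmod z < 1 -> Cmod (phi z) < 1) -> power_series_on_disk c phi ->
  forall g M, sum_n (fun m => Cmod (conv c g m) ^ 2) M <= sum_n (fun m => Cmod (g m) ^ 2) M.
Proof.
  intros Hphi Hc g M.
  set (X := sum_n (fun m => Cmod (conv c g m) ^ 2) M).
  set (Y := sum_n (fun m => Cmod (g m) ^ 2) M).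
  assert (HX : 0 <= X) by (apply rsum_ge0; intros; apply pow2_ge_0).
  assert (HY : 0 <= Y) by (apply rsum_ge0; intros; apply pow2_ge_0).
  assert (Main : forall r eta, 0 < r < 1 -> 0 < eta -> r ^ (2 * M) * X <= (1 + eta) ^ 2 * Y).
  { intros r eta Hr He. set (s := (1 + r) / 2).
    assert (Hs : r < s < 1) by (unfold s; lra).
    destruct (pseries_tail c s (phi (RtoC s))) as [B [HB0 HB]].
    { apply Hc. unfold in_disk. rewrite Cmod_R, Rabs_pos_eq; lra. }
    { lra. }
    assert (Hx : 0 <= r / s < 1).
    { split; [apply Rle_div_r; lra|apply Rlt_div_l; lra]. }
    destruct (pow_small (r / s) (eta / (B / (1 - r / s) + 1)) Hx) as [N HN].
    { apply Rdiv_lt_0_compat; [exact He|].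
      assert (0 <= B / (1 - r / s)); [|lra].
      apply Rmult_le_pos; [exact HB0|]. left; apply Rinv_0_lt_compat; lra. }
    (* [L >= N] makes the partial sum of [phi] accurate on the circle; [L >= M] makes the truncated
       product agree with [conv c g] up to [M]. *)
    set (L := max N M).
    assert (HL : forall z, Cmod z = r -> Cmod (cpoly c L z) <= 1 + eta).
    { intros z Hz. specialize (HB z (phi z) ltac:(lra)).
      assert (Hpz := Hphi z ltac:(lra)).
      specialize (HB (Hc z ltac:(unfold in_disk; lra)) L). rewrite Hz in HB.
      specialize (HN (S L) ltac:(unfold L; lia)).
      set (A := B / (1 - r / s)) in *.
      assert (HA : 0 <= A).
      { apply Rmult_le_pos; [exact HB0|]. left; apply Rinv_0_lt_compat; lra. }
      assert (HE : A * (r / s) ^ S L <= eta).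
      { apply (Rmult_lt_compat_l (A + 1)) in HN; [|lra].
        replace ((A + 1) * (eta / (A + 1))) with eta in HN by (field; lra).
        assert (0 <= (r / s) ^ S L) by (apply pow_le; lra). lra. }
      replace (cpoly c L z) with (phi z - (phi z - cpoly c L z))%C by ring.
      eapply Rle_trans; [apply Cmod_minus_le|]. lra. }
    set (D := (L + M)%nat).
    set (h := conv (trunc L c) (trunc M g)).
    assert (P1 := parseval h D r ltac:(lra)).
    assert (P2 := parseval (trunc M g) D r ltac:(lra)).
    assert (HN0 : 0 < INR (S D)) by (apply lt_0_INR; lia).
    assert (Hle : sum_n (fun k => Cmod (h k) ^ 2 * r ^ (2 * k)) D <=
      (1 + eta) ^ 2 * sum_n (fun k => Cmod (trunc M g k) ^ 2 * r ^ (2 * k)) D).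
    { apply Rmult_le_reg_l with (INR (S D)); [exact HN0|].
      rewrite <- P1, (Rmult_comm ((1 + eta) ^ 2)), <- Rmult_assoc, <- P2, (Rmult_comm _ ((1 + eta) ^ 2)), <- rsum_scal.
      apply rsum_le. intros j _. set (z := (RtoC r * cis _)%C).
      assert (Hz : Cmod z = r) by (apply Cmod_rcis; lra).
      unfold h, D. rewrite cpoly_conv_trunc, cpoly_trunc, Cmod_mult, Rpow_mult_distr by lia.
      apply Rmult_le_compat_r; [apply pow2_ge_0|].
      apply pow_incr. split; [apply Cmod_ge_0|auto]. }
    assert (Hr1 : forall k, 0 <= r ^ k <= 1).
    { intros k. split; [apply pow_le; lra|]. rewrite <- (pow1 k). apply pow_incr. lra. }
    assert (HgY : sum_n (fun k => Cmod (trunc M g k) ^ 2 * r ^ (2 * k)) D <= Y).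
    { apply Rle_trans with (sum_n (fun k => Cmod (trunc M g k) ^ 2) D).
      - apply rsum_le. intros k _. rewrite <- (Rmult_1_r (Cmod _ ^ 2)) at 2.
        apply Rmult_le_compat_l; [apply pow2_ge_0|apply Hr1].
      - assert (HMD : (M <= D)%nat) by (unfold D; lia).
        clear - HMD. induction HMD as [|n H IH].
        + right. apply sum_n_ext_loc. intros k Hk. now rewrite trunc_low.
        + rewrite rsum_S, trunc_high by lia. rewrite Cmod_0, pow_i, Rplus_0_r by lia. exact IH. }
    assert (HhX : r ^ (2 * M) * X <= sum_n (fun k => Cmod (h k) ^ 2 * r ^ (2 * k)) D).
    { apply Rle_trans with (sum_n (fun k => Cmod (h k) ^ 2 * r ^ (2 * k)) M).
      - unfold X. rewrite <- rsum_scal. apply rsum_le. intros k Hk.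
        unfold h. rewrite (conv_ext (trunc L c) (trunc M g) c g).
        + rewrite Rmult_comm. apply Rmult_le_compat_l; [apply pow2_ge_0|].
          replace (2 * M)%nat with (2 * k + 2 * (M - k))%nat by lia. rewrite pow_add.
          rewrite <- (Rmult_1_r (r ^ (2 * k))) at 2.
          apply Rmult_le_compat_l; apply Hr1.
        + intros i Hi. apply trunc_low. unfold L. lia.
        + intros i Hi. apply trunc_low. lia.
      - apply rsum_incr; [|unfold D; lia]. intros k.
        apply Rmult_le_pos; [apply pow2_ge_0|apply Hr1]. }
    eapply Rle_trans; [exact HhX|]. eapply Rle_trans; [exact Hle|].
    apply Rmult_le_compat_l; [apply pow2_ge_0|exact HgY]. }
  apply le_epsilon. intros eps He.
  set (n := (2 * M)%nat) in *.
  (* With [r = 1 - d] and [eta = d <= 1], the bounds [r ^ n >= 1 - n d] and [(1 + d) ^ 2 <= 1 + 3 d]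
     give [X <= Y + d (n X + 3 Y)]. *)
  set (T := INR n * X + 3 * Y + 1).
  assert (HT : 1 <= T).
  { unfold T. assert (0 <= INR n * X) by (apply Rmult_le_pos; [apply pos_INR|exact HX]). lra. }
  set (d := Rmin (1 / 2) (eps / T)).
  assert (Hd : 0 < d <= 1 / 2).
  { split; [apply Rmin_glb_lt; [lra|apply Rdiv_lt_0_compat; lra]|apply Rmin_l]. }
  assert (HdT : d * T <= eps).
  { apply Rle_div_r; [lra|apply Rmin_r]. }
  specialize (Main (1 - d) d ltac:(lra) ltac:(lra)).
  assert (Be := bernoulli_le d n ltac:(lra)).
  apply (Rmult_le_compat_r X) in Be; [|exact HX]. unfold T in HdT.
  assert (Hsq : 0 <= d * (1 - d) * Y) by (repeat apply Rmult_le_pos; lra).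
  lra.
Qed.

(** Horner's scheme: the series is [p_0 + phi * G], where [phi * G] has no constant term, so the
    squared norms add. Multiplication by [phi] contracts, and [G] is a series of the same kind with
    one term fewer. *)
Lemma littlewood (c : nat -> C) : c 0%nat = 0 ->
  (forall g M, sum_n (fun m => Cmod (conv c g m) ^ 2) M <= sum_n (fun m => Cmod (g m) ^ 2) M) ->
  forall N p M, sum_n (fun m => Cmod (sum_n (fun n => p n * cpow c n m)%C N) ^ 2) M <=
    sum_n (fun n => Cmod (p n) ^ 2) N.
Proof.
  intros Hc Hcon.
  assert (Hdelta : forall p0 (v : nat -> C) M, v 0%nat = 0 ->
    sum_n (fun m => Cmod (p0 * cpow c 0 m + v m) ^ 2) M =
    Cmod p0 ^ 2 + sum_n (fun m => Cmod (v m) ^ 2) M).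
  { intros p0 v M Hv. induction M as [|M IH].
    - rewrite !rsum_O, Hv, Cmod_0. simpl cpow.
      replace (p0 * 1 + 0)%C with p0 by ring. simpl. rring.
    - rewrite !rsum_S, IH. simpl cpow.
      replace (p0 * 0 + v (S M))%C with (v (S M)) by ring. rring. }
  induction N as [|N IH]; intros p M.
  - rewrite rsum_O.
    rewrite (sum_n_ext _ (fun m => Cmod (p 0%nat * cpow c 0 m + (fun _ => RtoC 0) m) ^ 2)).
    + rewrite Hdelta by reflexivity.
      rewrite (sum_n_ext _ (fun _ => 0)).
      * rewrite sum_n_const. lra.
      * intros m. rewrite Cmod_0. simpl. rring.
    + intros m. rewrite csum_O, Cplus_0_r. reflexivity.
  - set (G := fun m => sum_n (fun n => p (S n) * cpow c n m)%C N).
    rewrite (sum_n_ext _ (fun m => Cmod (p 0%nat * cpow c 0 m + conv c G m) ^ 2)).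
    + rewrite Hdelta.
      * rewrite rsum_shift. apply Rplus_le_compat_l.
        eapply Rle_trans; [apply Hcon|]. apply IH.
      * unfold conv. rewrite csum_O, Hc. ring.
    + intros m. rewrite csum_shift. do 3 f_equal. unfold conv, G. simpl cpow. unfold conv.
      rewrite (sum_n_ext _ (fun n => sum_n (fun i => c i * (p (S n) * cpow c n (m - i)%nat))%C m)).
      * rewrite sum_n_switch. apply sum_n_ext. intros i. now rewrite csum_scal.
      * intros n. rewrite <- csum_scal. apply sum_n_ext. intros i. cring.
Qed.

(** * Weighted estimates *)

Lemma rconv_sum (a b : nat -> R) M :
  sum_n (fun m => sum_n (fun i => a i * b (m - i)%nat) m) M =
  sum_n (fun i => a i * sum_n b (M - i)) M.
Proof.
  induction M as [|M IH]; [now rewrite !rsum_O|].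
  rewrite rsum_S, IH, !rsum_S, Nat.sub_diag, rsum_O.
  rewrite (sum_n_ext_loc (fun i => a i * sum_n b (S M - i))
    (fun i => a i * sum_n b (M - i) + a i * b (S M - i)%nat)).
  - rewrite rsum_plus. rring.
  - intros i Hi. replace (S M - i)%nat with (S (M - i)) by lia. rewrite rsum_S. rring.
Qed.

Lemma rconv_le (a b : nat -> R) M : (forall k, 0 <= a k) -> (forall k, 0 <= b k) ->
  sum_n (fun m => sum_n (fun i => a i * b (m - i)%nat) m) M <= sum_n a M * sum_n b M.
Proof.
  intros Ha Hb. rewrite rconv_sum, Rmult_comm, <- rsum_scal. apply rsum_le. intros i Hi.
  rewrite Rmult_comm. apply Rmult_le_compat_r; [apply Ha|]. apply rsum_incr; [exact Hb|lia].
Qed.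

(** The weighted [l^1] norm with weight [r ^ m] is submultiplicative for [conv]. *)
Lemma cpow_majorant (c : nat -> C) r q : 0 < r -> 0 <= q ->
  (forall M, sum_n (fun k => Cmod (c k) * r ^ k) M <= q) ->
  forall n M, sum_n (fun m => Cmod (cpow c n m) * r ^ m) M <= q ^ n.
Proof.
  intros Hr Hq Hc. assert (Hp : forall c k, 0 <= Cmod (c k) * r ^ k).
  { intros c' k. apply Rmult_le_pos; [apply Cmod_ge_0|apply pow_le; lra]. }
  induction n as [|n IH]; intros M.
  - simpl pow. induction M as [|M IH].
    + rewrite rsum_O. simpl. rewrite Cmod_1. lra.
    + rewrite rsum_S. change (cpow c 0 (S M)) with (RtoC 0). rewrite Cmod_0, Rmult_0_l, Rplus_0_r. exact IH.
  - apply Rle_trans with (sum_n (fun m => sum_n (fun i =>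
      (Cmod (c i) * r ^ i) * (Cmod (cpow c n (m - i)) * r ^ (m - i))) m) M).
    + apply rsum_le. intros m _. simpl cpow. unfold conv.
      rewrite Rmult_comm.
      eapply Rle_trans; [apply Rmult_le_compat_l; [apply pow_le; lra|apply Cmod_csum]|].
      rewrite <- rsum_scal. apply rsum_le. intros i Hi. right.
      rewrite Cmod_mult. replace (r ^ m) with (r ^ i * r ^ (m - i)).
      * ring.
      * rewrite <- pow_add. f_equal. lia.
    + eapply Rle_trans; [apply (rconv_le (fun i => Cmod (c i) * r ^ i)
        (fun j => Cmod (cpow c n j) * r ^ j)); apply Hp|].
      simpl. apply Rmult_le_compat; [| |apply Hc|apply IH]; apply rsum_ge0; intros; apply Hp.
Qed.

(** For small [r] the [l^1] norm of [phi] at radius [r] is at most [r * rho] with [rho < 1], so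
    [|A_(m,n)| r^(m-n) <= rho^n]. If [p (m - n) <= n], the factor [r^(m-n)] costs only part of this
    decay. The cube in [x ^ 3] leaves room for later splitting. *)
Lemma near_diagonal (c : nat -> C) : c 0%nat = 0 -> (forall k, Cmod (c k) <= 1) -> Cmod (c 1%nat) < 1 ->
  exists (p : nat) x, (1 <= p)%nat /\ 0 < x < 1 /\
    forall n m, (p * (m - n) <= n)%nat -> Cmod (cpow c n m) <= (x ^ 3) ^ n.
Proof.
  intros Hc0 Hc Hc1. set (t := Cmod (c 1%nat)) in *.
  assert (Ht : 0 <= t) by apply Cmod_ge_0.
  (* The terms of degree at least 2 then contribute at most [r ^ 2 / (1 - r) <= (4 / 3) * r ^ 2 = r
     * ((1 - t) / 3)], which explains [rho]. *)
  set (r := (1 - t) / 4). assert (Hr : 0 < r <= 1 / 4) by (unfold r; lra).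
  set (rho := t + (1 - t) / 3). assert (Hrho : 0 < rho < 1) by (unfold rho; lra).
  assert (Hmaj : forall M, sum_n (fun k => Cmod (c k) * r ^ k) M <= r * rho).
  { assert (Hpos : forall k, 0 <= Cmod (c k) * r ^ k).
    { intros k. apply Rmult_le_pos; [apply Cmod_ge_0|apply pow_le; lra]. }
    intros M. apply Rle_trans with (sum_n (fun k => Cmod (c k) * r ^ k) (S (S M))).
    { apply rsum_incr; [exact Hpos|lia]. }
    rewrite rsum_shift, rsum_shift, Hc0, Cmod_0. fold t.
    assert (H : sum_n (fun k => Cmod (c (S (S k))) * r ^ S (S k)) M <= r ^ 2 * / (1 - r)).
    { apply Rle_trans with (sum_n (fun k => r ^ 2 * r ^ k) M).
      - apply rsum_le. intros k _. rewrite <- pow_add.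
        rewrite <- (Rmult_1_l (r ^ (2 + k))). apply Rmult_le_compat_r; [apply pow_le; lra|apply Hc].
      - rewrite rsum_scal. apply Rmult_le_compat_l; [apply pow_le; lra|].
        apply rsum_geom; lra. }
    assert (H2 : / (1 - r) <= 4 / 3).
    { replace (4 / 3) with (/ (3 / 4)) by field. apply Rinv_le_contravar; lra. }
    assert (H3 : r ^ 2 * / (1 - r) <= r * ((1 - t) / 3)).
    { apply Rle_trans with (r ^ 2 * (4 / 3)).
      - apply Rmult_le_compat_l; [apply pow_le; lra|exact H2].
      - unfold r. right; field. }
    change (Cmod (c 1%nat)) with t. rewrite Rmult_0_l, Rplus_0_l, pow_1.
    unfold rho. rewrite Rmult_plus_distr_l, (Rmult_comm r t). apply Rplus_le_compat_l.
    exact (Rle_trans _ _ _ H H3). }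
  (* By Bernoulli [x ^ 6 >= 1 - 6 d = rho], so [rho ^ n] is at most [y ^ n * y ^ n] with
     [y = x ^ 3]: one factor absorbs [r ^ e], the other is the final bound. *)
  set (d := (1 - rho) / 6). set (x := 1 - d).
  assert (Hx : 0 < x < 1) by (unfold x, d; lra).
  assert (Hx6 : rho <= x ^ 3 * x ^ 3).
  { assert (Be := bernoulli_le d 6 ltac:(unfold d; lra)). fold x in Be.
    rewrite <- pow_add. simpl Nat.add. simpl INR in Be. unfold d in Be. lra. }
  set (y := x ^ 3) in *.
  assert (Hy : 0 < y < 1).
  { unfold y. split; [apply pow_lt; lra|]. rewrite <- (pow1 3). simpl. nra. }
  destruct (pow_small y r ltac:(lra) ltac:(lra)) as [P HP].
  exists (S P), x. split; [lia|]. split; [exact Hx|]. intros n m Hnm.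
  fold y. specialize (HP (S P) ltac:(lia)).
  assert (Hyn : 0 < y ^ n) by (apply pow_lt; lra).
  destruct (Nat.lt_ge_cases m n) as [Hlt|Hge].
  { rewrite cpow_low by assumption. rewrite Cmod_0. lra. }
  assert (Hm := cpow_majorant c r (r * rho) ltac:(lra) ltac:(nra) Hmaj n m).
  assert (Hterm : Cmod (cpow c n m) * r ^ m <= (r * rho) ^ n).
  { eapply Rle_trans; [|exact Hm]. apply (rsum_term (fun m => Cmod (cpow c n m) * r ^ m)); [|lia].
    intros k. apply Rmult_le_pos; [apply Cmod_ge_0|apply pow_le; lra]. }
  set (e := (m - n)%nat) in *. replace m with (n + e)%nat in Hterm at 2 by (unfold e; lia).
  rewrite pow_add, Rpow_mult_distr in Hterm.
  assert (Hrn : 0 < r ^ n) by (apply pow_lt; lra).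
  assert (H1 : Cmod (cpow c n m) * r ^ e <= rho ^ n).
  { apply Rmult_le_reg_l with (r ^ n); [exact Hrn|]. lra. }
  assert (H2 : y ^ n <= r ^ e).
  { apply Rle_trans with (y ^ (S P * e)).
    - replace n with (S P * e + (n - S P * e))%nat by lia. rewrite pow_add.
      rewrite <- (Rmult_1_r (y ^ (S P * e))) at 2. apply Rmult_le_compat_l; [apply pow_le; lra|].
      rewrite <- (pow1 (n - S P * e)). apply pow_incr. lra.
    - rewrite pow_mult. apply pow_incr. split; [apply pow_le|]; lra. }
  apply Rmult_le_reg_r with (y ^ n); [exact Hyn|].
  eapply Rle_trans; [apply Rmult_le_compat_l; [apply Cmod_ge_0|exact H2]|].
  eapply Rle_trans; [exact H1|]. rewrite <- Rpow_mult_distr. apply pow_incr. lra.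
Qed.

(** * Hilbert-Schmidt bound for weighted matrices *)

Lemma cauchy_schwarz_weighted (e a v : nat -> R) N : (forall n, 0 < v n) ->
  (sum_n (fun n => e n * a n) N) ^ 2 <=
  sum_n (fun n => e n ^ 2 / v n) N * sum_n (fun n => v n * a n ^ 2) N.
Proof.
  intros Hv.
  assert (He : forall n, 0 <= e n ^ 2 / v n).
  { intros n. apply Rmult_le_pos; [apply pow2_ge_0|]. left; apply Rinv_0_lt_compat, Hv. }
  assert (Ha : forall n, 0 <= v n * a n ^ 2).
  { intros n. apply Rmult_le_pos; [left; apply Hv|apply pow2_ge_0]. }
  induction N as [|N IH].
  - rewrite !rsum_O. right. field. apply Rgt_not_eq, Hv.
  - rewrite !rsum_S.
    assert (HP := rsum_ge0 _ N (fun k _ => He k)). assert (HQ := rsum_ge0 _ N (fun k _ => Ha k)).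
    cbv beta in HP, HQ.
    specialize (Hv (S N)). revert HP HQ IH.
    generalize (sum_n (fun n => e n * a n) N) (sum_n (fun n => e n ^ 2 / v n) N)
      (sum_n (fun n => v n * a n ^ 2) N).
    intros X P Q HP HQ IH. change R in X, P, Q.
    set (E := e (S N)) in *. set (A := a (S N)) in *. set (w := v (S N)) in *.
    assert (Hal : 0 <= P * (w * A ^ 2)) by (apply Rmult_le_pos; [exact HP|apply (Ha (S N))]).
    assert (Hbe : 0 <= E ^ 2 / w * Q) by (apply Rmult_le_pos; [apply (He (S N))|exact HQ]).
    (* Arithmetic-geometric mean: the two terms on the right have product [P * Q * (E * A) ^ 2], at
       least [(X * (E * A)) ^ 2] by induction. *)
    assert (Hm : 2 * (X * (E * A)) <= P * (w * A ^ 2) + E ^ 2 / w * Q).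
    { apply Rle_trans with (1 := Rle_abs _). rewrite <- (Rabs_pos_eq (_ + _)) by lra.
      apply Rsqr_le_abs_0. unfold Rsqr.
      set (al := P * (w * A ^ 2)) in *. set (be := E ^ 2 / w * Q) in *.
      assert (Hprod : X ^ 2 * (E * A) ^ 2 <= al * be).
      { replace (al * be) with (P * Q * (E * A) ^ 2) by (unfold al, be; field; lra).
        apply Rmult_le_compat_r; [apply pow2_ge_0|exact IH]. }
      assert (Hsq := pow2_ge_0 (al - be)). nra. }
    assert (Hd : E ^ 2 / w * (w * A ^ 2) = (E * A) ^ 2) by (field; lra).
    nra.
Qed.

Lemma hilbert_schmidt (E : nat -> nat -> C) (w v : nat -> R) K x :
  (forall m, 0 <= w m) -> (forall n, 0 < v n) -> 0 <= K -> 0 <= x < 1 ->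
  (forall m n, Cmod (E m n) ^ 2 * w m <= K * x ^ (n + m) * v n) ->
  forall a M N, sum_n (fun m => w m * Cmod (sum_n (fun n => a n * E m n)%C N) ^ 2) M <=
    K / (1 - x) ^ 2 * sum_n (fun n => v n * Cmod (a n) ^ 2) N.
Proof.
  intros Hw Hv HK Hx HE a M N.
  set (Q := sum_n (fun n => v n * Cmod (a n) ^ 2) N).
  assert (HQ : 0 <= Q).
  { apply rsum_ge0. intros n _. apply Rmult_le_pos; [left; apply Hv|apply pow2_ge_0]. }
  assert (Hx1 : 0 < / (1 - x)) by (apply Rinv_0_lt_compat; lra).
  apply Rle_trans with (sum_n (fun m => (K * / (1 - x) * Q) * x ^ m) M).
  - apply rsum_le. intros m _.
    apply Rle_trans with (w m * (sum_n (fun n => Cmod (E m n) ^ 2 / v n) N * Q)).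
    + apply Rmult_le_compat_l; [apply Hw|].
      eapply Rle_trans; [|apply (cauchy_schwarz_weighted (fun n => Cmod (E m n)) (fun n => Cmod (a n)) v N Hv)].
      apply pow_incr. split; [apply Cmod_ge_0|]. eapply Rle_trans; [apply Cmod_csum|].
      apply rsum_le. intros n _. rewrite Cmod_mult. lra.
    + rewrite <- Rmult_assoc, <- rsum_scal.
      replace (K * / (1 - x) * Q * x ^ m) with (K * x ^ m * / (1 - x) * Q) by ring.
      apply Rmult_le_compat_r; [exact HQ|].
      apply Rle_trans with (sum_n (fun n => K * x ^ m * x ^ n) N).
      * apply rsum_le. intros n _. specialize (HE m n). rewrite pow_add in HE.
        apply Rmult_le_reg_r with (v n); [apply Hv|].
        replace (w m * (Cmod (E m n) ^ 2 / v n) * v n) with (Cmod (E m n) ^ 2 * w m)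
          by (field; apply Rgt_not_eq, Hv).
        lra.
      * rewrite rsum_scal. apply Rmult_le_compat_l; [|now apply rsum_geom].
        apply Rmult_le_pos; [exact HK|apply pow_le; lra].
  - rewrite rsum_scal.
    replace (K / (1 - x) ^ 2 * Q) with (K * / (1 - x) * Q * / (1 - x)) by (field; lra).
    apply Rmult_le_compat_l; [|now apply rsum_geom].
    repeat apply Rmult_le_pos; lra.
Qed.

(** * Abel summation against a decreasing weight *)

Lemma abel_identity (W f : nat -> R) N :
  sum_n (fun m => W m * f m) N =
  sum_n (fun m => (W m - W (S m)) * sum_n f m) N + W (S N) * sum_n f N.
Proof.
  induction N as [|N IH]; [rewrite !rsum_O; rring|].
  rewrite !rsum_S, IH. rring.
Qed.

(** If the partial sums of [f] up to [m] only see the [g n] with [chi m n], then [f] weighted by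
    a decreasing [W] only sees [g n] with the weight of the first [m] such that [chi m n]. *)
Lemma abel_transfer (W f g V : nat -> R) (chi : nat -> nat -> bool) K N :
  (forall m, 0 <= W m) -> (forall m, W (S m) <= W m) -> (forall n, 0 <= g n) -> 0 <= K ->
  (forall m n, chi m n = true -> chi (S m) n = true) ->
  (forall n, 0 <= V n) -> (forall m n, chi m n = true -> W m <= V n) ->
  (forall m, sum_n f m <= K * sum_n (fun n => if chi m n then g n else 0) N) ->
  sum_n (fun m => W m * f m) N <= K * sum_n (fun n => V n * g n) N.
Proof.
  intros HW0 HW Hg HK Hchi HV0 HV Hf.
  rewrite abel_identity.
  set (x := fun m n => if chi m n then 1 else 0).
  (* For fixed [n] this bracket is 0 as long as [chi j n] fails; afterwards it telescopes to [W] at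
     the first index where [chi] holds. The vanishing is recorded to start the second phase of the
     induction. *)
  assert (Hbr : forall n j, (chi j n = false ->
      sum_n (fun m => (W m - W (S m)) * x m n) j + W (S j) * x j n = 0) /\
      sum_n (fun m => (W m - W (S m)) * x m n) j + W (S j) * x j n <= V n).
  { intros n. unfold x. induction j as [|j [IH1 IH2]].
    - rewrite rsum_O. destruct (chi 0%nat n) eqn:E.
      + split; [discriminate|]. specialize (HV _ _ E). lra.
      + split; intros; specialize (HV0 n); lra.
    - rewrite rsum_S. destruct (chi (S j) n) eqn:E.
      + split; [discriminate|]. specialize (HV _ _ E). destruct (chi j n) eqn:E'.
        * lra.
        * specialize (IH1 eq_refl). lra.
      + destruct (chi j n) eqn:E'; [rewrite (Hchi _ _ E') in E; discriminate|].
        specialize (IH1 eq_refl). specialize (HV0 n). split; intros; lra. }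
  apply Rle_trans with (sum_n (fun m => K * sum_n (fun n => g n * ((W m - W (S m)) * x m n)) N) N +
     K * sum_n (fun n => g n * (W (S N) * x N n)) N).
  - apply Rplus_le_compat.
    + apply rsum_le. intros m _.
      apply Rle_trans with ((W m - W (S m)) * (K * sum_n (fun n => if chi m n then g n else 0) N)).
      * apply Rmult_le_compat_l; [specialize (HW m); lra|apply Hf].
      * right. rewrite <- Rmult_assoc, (Rmult_comm _ K), Rmult_assoc. f_equal.
        rewrite <- rsum_scal. apply sum_n_ext. intros n. unfold x. destruct (chi m n); rring.
    + apply Rle_trans with (W (S N) * (K * sum_n (fun n => if chi N n then g n else 0) N)).
      * apply Rmult_le_compat_l; [apply HW0|apply Hf].
      * right. rewrite <- Rmult_assoc, (Rmult_comm _ K), Rmult_assoc. f_equal.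
        rewrite <- rsum_scal. apply sum_n_ext. intros n. unfold x. destruct (chi N n); rring.
  - rewrite rsum_scal, <- Rmult_plus_distr_l. apply Rmult_le_compat_l; [exact HK|].
    rewrite sum_n_switch, <- rsum_plus. apply rsum_le. intros n _.
    rewrite rsum_scal, <- Rmult_plus_distr_l, Rmult_comm.
    apply Rmult_le_compat_r; [apply Hg|apply Hbr].
Qed.

(** [W m] is the supremum of the tail from [m]. The last clause, its leastness, is what lets weak
    decrease bound [W]. *)
Lemma decreasing_envelope (beta : nat -> R) B : (forall n, 0 < beta n) -> (forall n, beta n <= B) ->
  exists W : nat -> R, (forall m, beta m <= W m) /\ (forall m, W (S m) <= W m) /\
    forall m V, (forall k, (m <= k)%nat -> beta k <= V) -> W m <= V.
Proof.
  intros Hpos HB.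
  assert (L : forall m, {w | is_lub (fun y => exists k, (m <= k)%nat /\ y = beta k) w}).
  { intros m. apply completeness.
    - exists B. intros y [k [_ ->]]. apply HB.
    - exists (beta m), m. auto. }
  exists (fun m => proj1_sig (L m)). split; [|split].
  - intros m. apply (proj2_sig (L m)). exists m; auto.
  - intros m. apply (proj2_sig (L (S m))). intros y [k [Hk ->]].
    apply (proj2_sig (L m)). exists k. split; [lia|reflexivity].
  - intros m V HV. apply (proj2_sig (L m)). intros y [k [Hk ->]]. now apply HV.
Qed.

(** Every [m >= 1] satisfies [m > (1 + delta) * 0], so comparison with [beta 0] gives a bound;
    [delta = 1] is arbitrary. *)
Lemma weakly_decreasing_bounded beta : positive_seq beta -> weakly_decreasing beta ->
  exists B, 0 < B /\ forall n, beta n <= B.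
Proof.
  intros Hpos H. destruct (H 1 Rlt_0_1) as [K [HK HKn]].
  exists (K * beta 0%nat + beta 0%nat). assert (H0 := Hpos 0%nat). split; [nra|].
  intros [|n]; [nra|]. specialize (HKn (S n) 0%nat).
  assert (HS : 0 < INR (S n)) by (apply lt_0_INR; lia). simpl INR at 2 in HKn.
  specialize (HKn ltac:(lra)). lra.
Qed.

Lemma decay_subexponential beta tau : positive_seq beta -> polynomial_decay beta -> 0 < tau < 1 ->
  exists D, 0 < D /\ forall n, tau ^ n <= D * beta n.
Proof.
  intros Hpos (c & alpha & Hc & Hal & H) Htau.
  set (l := - ln tau).
  assert (Hl : 0 < l).
  { unfold l. rewrite <- Ropp_0. apply Ropp_lt_contravar. rewrite <- ln_1. apply ln_increasing; lra. }
  (* As [alpha * eps = l], the tangent bound [ln s <= eps * s - 1 - ln eps] times [alpha] reads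
     [s ^ alpha <= C0 * tau ^ (- s)]. *)
  set (eps := l / alpha). assert (He : 0 < eps) by now apply Rdiv_lt_0_compat.
  set (C0 := exp (- alpha * (1 + ln eps))).
  (* The second summand covers [n = 0], where polynomial decay says nothing. *)
  exists (C0 / c + / beta 0%nat).
  assert (HC0 : 0 < C0 / c) by (apply Rdiv_lt_0_compat; [apply exp_pos|exact Hc]).
  assert (Hb0 : 0 < / beta 0%nat) by apply Rinv_0_lt_compat, Hpos.
  split; [lra|]. intros [|n].
  { simpl. rewrite Rmult_plus_distr_r, Rinv_l by apply Rgt_not_eq, Hpos.
    specialize (Hpos 0%nat). nra. }
  specialize (H (S n) ltac:(lia)).
  assert (HS : 0 < INR (S n)) by (apply lt_0_INR; lia).
  set (s := INR (S n)) in *.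
  assert (Hln : ln s <= eps * s - 1 - ln eps).
  { assert (E := exp_ineq1_le (ln (eps * s))).
    rewrite exp_ln in E by now apply Rmult_lt_0_compat.
    rewrite ln_mult in E by assumption. lra. }
  assert (Hpow : tau ^ S n = exp (- l * s)).
  { rewrite <- Rpower_pow by lra. unfold Rpower, l. f_equal. unfold s. ring. }
  rewrite Hpow.
  apply Rle_trans with (C0 / c * beta (S n)).
  - apply Rle_trans with (C0 / c * (c * Rpower s (- alpha))).
    + replace (C0 / c * (c * Rpower s (- alpha))) with (C0 * Rpower s (- alpha)) by (field; lra).
      unfold C0, Rpower. rewrite <- exp_plus.
      assert (Hexp : - l * s <= - alpha * (1 + ln eps) + - alpha * ln s).
      { replace (- l * s) with (- alpha * (eps * s)) by (unfold eps; field; lra). nra. }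
      destruct Hexp as [Hexp| ->]; [left; now apply exp_increasing|lra].
    + apply Rmult_le_compat_l; [lra|exact H].
  - specialize (Hpos (S n)). nra.
Qed.

Lemma Cmod_plus_sq (u v : C) : Cmod (u + v) ^ 2 <= 2 * Cmod u ^ 2 + 2 * Cmod v ^ 2.
Proof.
  assert (T := Cmod_triangle u v). assert (H := Cmod_ge_0 (u + v)).
  assert (H2 := pow2_ge_0 (Cmod u - Cmod v)).
  apply Rle_trans with ((Cmod u + Cmod v) ^ 2); [now apply pow_incr|nra].
Qed.

(** For [m <= N] and [c 0 = 0] this is already the full coefficient, by triangularity. *)
Definition subst_coef (c a : nat -> C) (N m : nat) : C := sum_n (fun n => a n * cpow c n m)%C N.

Lemma substitution_bounded beta (c : nat -> C) : positive_seq beta -> polynomial_decay beta ->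
  weakly_decreasing beta -> c 0%nat = 0 -> (forall k, Cmod (c k) <= 1) -> Cmod (c 1%nat) < 1 ->
  (forall g M, sum_n (fun m => Cmod (conv c g m) ^ 2) M <= sum_n (fun m => Cmod (g m) ^ 2) M) ->
  exists K, 0 <= K /\ forall a N,
    sum_n (fun m => beta m * Cmod (subst_coef c a N m) ^ 2) N <=
    K * sum_n (fun n => beta n * Cmod (a n) ^ 2) N.
Proof.
  intros Hpos Hdec Hwd Hc0 Hc Hc1 Hcon.
  destruct (near_diagonal c Hc0 Hc Hc1) as (p & x & Hp & Hx & Hnear).
  destruct (weakly_decreasing_bounded beta Hpos Hwd) as (B & HB & HBn).
  destruct (decreasing_envelope beta B Hpos HBn) as (W & HW1 & HW2 & HW3).
  set (y := x ^ 3) in *.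
  assert (Hy : 0 < y < 1).
  { unfold y. split; [apply pow_lt; lra|]. simpl. nra. }
  destruct (decay_subexponential beta y Hpos Hdec Hy) as (D & HD & HDn).
  (* [far m n] below amounts to [m > (1 + 1 / p) n], so the smaller [delta = 1 / (p + 1)] applies to
     far entries. *)
  destruct (Hwd (/ (INR p + 1))) as (Kw & HKw & Hwk).
  { apply Rinv_0_lt_compat. generalize (pos_INR p). lra. }
  (* Subtraction is truncated: entries with [m < n] count as near, and they vanish. *)
  set (far := fun m n => Nat.ltb n (p * (m - n))).
  set (E := fun m n => if far m n then RtoC 0 else cpow c n m).
  set (U := fun m n => if far m n then cpow c n m else RtoC 0).
  (* The squared bound is [y ^ n * x ^ (3 * n)]. The factor [y ^ n] will pay for the polynomial
     decay of [beta], and [3 * n >= n + m] near the diagonal gives summability in both indices. *)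
  assert (HE : forall m n, Cmod (E m n) ^ 2 <= y ^ n * x ^ (n + m)).
  { intros m n. assert (P : 0 <= y ^ n * x ^ (n + m)) by (apply Rmult_le_pos; apply pow_le; lra).
    unfold E, far. destruct (Nat.ltb_spec n (p * (m - n))) as [H|H].
    { rewrite Cmod_0. simpl. lra. }
    destruct (Nat.lt_ge_cases m n) as [H1|H1].
    { rewrite cpow_low by assumption. rewrite Cmod_0. simpl. lra. }
    specialize (Hnear n m H).
    apply Rle_trans with ((y ^ n) ^ 2); [apply pow_incr; split; [apply Cmod_ge_0|exact Hnear]|].
    simpl. rewrite Rmult_1_r. apply Rmult_le_compat_l; [apply pow_le; lra|].
    unfold y. rewrite <- pow_mult.
    assert (Hm : (n + m <= 3 * n)%nat) by nia.
    replace (3 * n)%nat with ((n + m) + (3 * n - (n + m)))%nat by lia. rewrite pow_add.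
    rewrite <- (Rmult_1_r (x ^ (n + m))) at 2. apply Rmult_le_compat_l; [apply pow_le; lra|].
    rewrite <- (pow1 (3 * n - (n + m))). apply pow_incr. lra. }
  assert (HEw : forall m n, Cmod (E m n) ^ 2 * beta m <= (B * D) * x ^ (n + m) * beta n).
  { intros m n. apply Rle_trans with (y ^ n * x ^ (n + m) * B).
    - apply Rmult_le_compat; [apply pow2_ge_0|left; apply Hpos|apply HE|apply HBn].
    - assert (P : 0 <= x ^ (n + m) * B) by (apply Rmult_le_pos; [apply pow_le|]; lra).
      specialize (HDn n). apply (Rmult_le_compat_r _ _ _ P) in HDn. lra. }
  assert (HE1 : forall m n, Cmod (E m n) ^ 2 * 1 <= 1 * x ^ (n + m) * 1).
  { intros m n. specialize (HE m n).
    assert (P : 0 <= x ^ (n + m)) by (apply pow_le; lra).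
    assert (Q : y ^ n <= 1) by (rewrite <- (pow1 n); apply pow_incr; lra).
    nra. }
  assert (HS1 := hilbert_schmidt E (fun _ => 1) (fun _ => 1) 1 x (fun _ => Rle_0_1) (fun _ => Rlt_0_1)
    Rle_0_1 ltac:(lra) HE1).
  assert (HS2 := hilbert_schmidt E beta beta (B * D) x (fun m => Rlt_le _ _ (Hpos m)) Hpos
    ltac:(nra) ltac:(lra) HEw).
  set (K1 := 1 / (1 - x) ^ 2) in *. set (K2 := B * D / (1 - x) ^ 2) in *.
  assert (Hx2 : 0 < (1 - x) ^ 2) by (apply pow_lt; lra).
  assert (HK1 : 0 < K1) by (apply Rdiv_lt_0_compat; lra).
  assert (HK2 : 0 < K2) by (apply Rdiv_lt_0_compat; [nra|lra]).
  assert (Hsplit : forall a N m, subst_coef c a N m =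
    (sum_n (fun n => a n * E m n) N + sum_n (fun n => a n * U m n) N)%C).
  { intros a N m. unfold subst_coef. rewrite <- csum_plus. apply sum_n_ext. intros n.
    unfold E, U. destruct (far m n); cring. }
  (* [U] is the whole matrix minus [E]; the 2 comes from Littlewood's contraction and [2 * K1] from
     the Hilbert-Schmidt bound. *)
  assert (HU : forall a N M, sum_n (fun m => Cmod (sum_n (fun n => a n * U m n)%C N) ^ 2) M <=
    (2 + 2 * K1) * sum_n (fun n => Cmod (a n) ^ 2) N).
  { intros a N M.
    specialize (HS1 a M N). cbv beta in HS1.
    rewrite (sum_n_ext (fun n => 1 * Cmod (a n) ^ 2) (fun n => Cmod (a n) ^ 2)) in HS1 by (intros; rring).
    assert (HL := littlewood c Hc0 Hcon N a M).
    apply Rle_trans with (sum_n (fun m => 2 * Cmod (subst_coef c a N m) ^ 2 +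
      2 * (1 * Cmod (sum_n (fun n => a n * E m n)%C N) ^ 2)) M).
    - apply rsum_le. intros m _.
      replace (sum_n (fun n => a n * U m n)%C N : C) with
        (subst_coef c a N m + - sum_n (fun n => a n * E m n)%C N)%C by (rewrite Hsplit; cring).
      eapply Rle_trans; [apply Cmod_plus_sq|]. rewrite Cmod_opp. lra.
    - rewrite rsum_plus, !(rsum_scal 2). unfold subst_coef.
      eapply Rle_trans; [apply Rplus_le_compat; (apply Rmult_le_compat_l; [lra|eassumption])|].
      right. rring. }
  (* [far] is monotone in [m], so a column not yet far at row [M] is zero in all earlier rows of
     [U]. Its coefficient may be replaced by 0. *)
  assert (HUfar : forall a N M, sum_n (fun m => Cmod (sum_n (fun n => a n * U m n)%C N) ^ 2) M <=
    (2 + 2 * K1) * sum_n (fun n => if far M n then Cmod (a n) ^ 2 else 0) N).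
  { intros a N M. set (a' := fun n => if far M n then a n else RtoC 0).
    specialize (HU a' N M).
    rewrite (sum_n_ext (fun n => Cmod (a' n) ^ 2) (fun n => if far M n then Cmod (a n) ^ 2 else 0)) in HU.
    - eapply Rle_trans; [|exact HU]. apply rsum_le. intros m Hm. right. do 2 f_equal.
      apply sum_n_ext. intros n. unfold a', U.
      destruct (far M n) eqn:E1; [reflexivity|].
      destruct (far m n) eqn:E2; [|cring]. exfalso. unfold far in E1, E2.
      apply Nat.ltb_ge in E1. apply Nat.ltb_lt in E2. nia.
    - intros n. unfold a'. destruct (far M n); [reflexivity|]. rewrite Cmod_0. simpl. rring. }
  assert (HUw : forall a N, sum_n (fun m => beta m * Cmod (sum_n (fun n => a n * U m n)%C N) ^ 2) N <=
    (2 + 2 * K1) * sum_n (fun n => Kw * beta n * Cmod (a n) ^ 2) N).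
  { intros a N.
    apply Rle_trans with (sum_n (fun m => W m * Cmod (sum_n (fun n => a n * U m n)%C N) ^ 2) N).
    - apply rsum_le. intros m _. apply Rmult_le_compat_r; [apply pow2_ge_0|apply HW1].
    - apply (abel_transfer W _ (fun n => Cmod (a n) ^ 2) (fun n => Kw * beta n) far).
      + intros m. apply Rle_trans with (beta m); [left; apply Hpos|apply HW1].
      + exact HW2.
      + intros n. apply pow2_ge_0.
      + lra.
      + intros m n H. unfold far in *. apply Nat.ltb_lt in H. apply Nat.ltb_lt. nia.
      + intros n. apply Rmult_le_pos; [lra|left; apply Hpos].
      + intros m n H. apply HW3. intros k Hk. apply Hwk.
        unfold far in H. apply Nat.ltb_lt in H.
        assert (Hk2 : (n < p * (k - n))%nat) by nia.
        assert (Hkn : (n < k)%nat) by nia.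
        apply lt_INR in Hk2. rewrite mult_INR, minus_INR in Hk2 by lia.
        assert (Hp0 : 1 <= INR p) by (apply (le_INR 1); exact Hp).
        assert (Hn0 := pos_INR n). assert (Hi : 0 < / (INR p + 1)) by (apply Rinv_0_lt_compat; lra).
        apply Rmult_lt_reg_l with (INR p + 1); [lra|].
        replace ((INR p + 1) * ((1 + / (INR p + 1)) * INR n)) with ((INR p + 2) * INR n) by (field; lra).
        apply lt_INR in Hkn. nra.
      + intros M. apply HUfar. }
  exists (2 * K2 + 2 * ((2 + 2 * K1) * Kw)). split; [nra|]. intros a N.
  apply Rle_trans with (sum_n (fun m => 2 * (beta m * Cmod (sum_n (fun n => a n * E m n)%C N) ^ 2) +
     2 * (beta m * Cmod (sum_n (fun n => a n * U m n)%C N) ^ 2)) N).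
  - apply rsum_le. intros m _. rewrite Hsplit.
    match goal with |- _ * Cmod (?u + ?v) ^ 2 <= _ => assert (Q := Cmod_plus_sq u v) end.
    apply (Rmult_le_compat_l (beta m)) in Q; [|left; apply Hpos]. lra.
  - rewrite rsum_plus, !(rsum_scal 2).
    specialize (HS2 a N N). specialize (HUw a N).
    rewrite (sum_n_ext (fun n => Kw * beta n * Cmod (a n) ^ 2) (fun n => Kw * (beta n * Cmod (a n) ^ 2)))
      in HUw by (intros; rring).
    rewrite rsum_scal in HUw.
    eapply Rle_trans; [apply Rplus_le_compat; (apply Rmult_le_compat_l; [lra|eassumption])|].
    right. rring.
Qed.

(** * Composition operators *)

Lemma cderiv_is_derive (f : C -> C) (z l : C) :
  cderiv f z l -> @is_derive C_AbsRing C_NormedModule f z l.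
Proof.
  intros H. split; [apply is_linear_scal_l|]. intros x Hx.
  apply (is_filter_lim_locally_unique (K := C_AbsRing) (V := AbsRing_NormedModule C_AbsRing)) in Hx.
  rewrite <- Hx. clear x Hx.
  intros eps. destruct (H eps (cond_pos eps)) as [d [Hd D]].
  exists (mkposreal d Hd). intros w Hw. exact (D w Hw).
Qed.

Lemma cderiv_comp f g z l k : cderiv f (g z) l -> cderiv g z k ->
  cderiv (fun w => f (g w)) z (k * l).
Proof.
  intros Hf Hg. apply is_derive_cderiv.
  apply cderiv_is_derive in Hf.
  apply (is_derive_comp (K := C_AbsRing) (V := C_NormedModule) f g z l k Hf).
  split; [apply is_linear_scal_l|]. intros x Hx.
  apply (is_filter_lim_locally_unique (K := C_AbsRing) (V := AbsRing_NormedModule C_AbsRing)) in Hx.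
  rewrite <- Hx. clear x Hx.
  intros eps. destruct (Hg eps (cond_pos eps)) as [d [Hd D]].
  exists (mkposreal d Hd). intros w Hw. exact (D w Hw).
Qed.

Lemma analytic_cderiv f : analytic_on_disk f ->
  forall w, Cmod w < 1 -> exists l, cderiv f w l.
Proof. intros H w Hw. destruct (H w Hw) as [l Hl]. exists l. now apply is_derive_cderiv. Qed.

(** The contraction is applied to the constant function 1. *)
Lemma coef_norm_le1 (c : nat -> C) :
  (forall g M, sum_n (fun m => Cmod (conv c g m) ^ 2) M <= sum_n (fun m => Cmod (g m) ^ 2) M) ->
  forall M, sum_n (fun k => Cmod (c k) ^ 2) M <= 1.
Proof.
  intros H M. specialize (H (cpow c 0) M).
  assert (E : forall m, conv c (cpow c 0) m = c m).
  { intros m. unfold conv.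
    transitivity (sum_n (fun i => if Nat.eqb i m then c i else RtoC 0) m).
    - apply sum_n_ext_loc. intros i Hi. destruct (Nat.eqb_spec i m) as [->|Hne].
      + rewrite Nat.sub_diag. simpl. cring.
      + destruct (m - i)%nat eqn:Em; [lia|]. simpl. cring.
    - now apply csum_delta. }
  rewrite (sum_n_ext _ (fun k => Cmod (c k) ^ 2)) in H by (intros m; now rewrite E).
  eapply Rle_trans; [exact H|]. clear. induction M as [|M IH].
  - rewrite rsum_O. simpl. rewrite Cmod_1. lra.
  - rewrite rsum_S. change (cpow c 0 (S M)) with (RtoC 0).
    rewrite Cmod_0, pow_i, Rplus_0_r by lia. exact IH.
Qed.

Lemma rotation_coef (c : nat -> C) : (forall k, k <> 1%nat -> c k = 0) ->
  forall n m, cpow c n m = if Nat.eqb n m then (c 1%nat ^ n)%C else RtoC 0.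
Proof.
  intros Hc. induction n as [|n IH]; intros m; [now destruct m|].
  simpl cpow. unfold conv.
  transitivity (sum_n (fun i => if Nat.eqb i 1 then (c i * cpow c n (m - i)%nat)%C else RtoC 0) m).
  - apply sum_n_ext. intros i. destruct (Nat.eqb_spec i 1) as [->|Hne]; [reflexivity|].
    rewrite Hc by assumption. cring.
  - destruct m as [|m].
    + rewrite csum_O. reflexivity.
    + rewrite (csum_delta (fun i => (c i * cpow c n (S m - i)%nat)%C)) by lia.
      replace (S m - 1)%nat with m by lia. rewrite IH. simpl Nat.eqb.
      destruct (Nat.eqb n m); simpl; cring.
Qed.

(** Equality in Schwarz's lemma is read off the coefficients: [sum |c_k|^2 <= 1] and [|c_1| = 1]
    force all the others to vanish. The matrix is then diagonal with unimodular entries, and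
    [K = 1]. *)
Lemma substitution_bounded_self_map beta (c : nat -> C) : positive_seq beta -> polynomial_decay beta ->
  weakly_decreasing beta -> c 0%nat = 0 ->
  (forall g M, sum_n (fun m => Cmod (conv c g m) ^ 2) M <= sum_n (fun m => Cmod (g m) ^ 2) M) ->
  exists K, 0 <= K /\ forall a N,
    sum_n (fun m => beta m * Cmod (subst_coef c a N m) ^ 2) N <=
    K * sum_n (fun n => beta n * Cmod (a n) ^ 2) N.
Proof.
  intros Hpos Hdec Hwd Hc0 Hcon. assert (Hn := coef_norm_le1 c Hcon).
  assert (Hc : forall k, Cmod (c k) <= 1).
  { intros k. assert (T := rsum_term (fun k => Cmod (c k) ^ 2) k k (fun k => pow2_ge_0 _) (Nat.le_refl k)).
    specialize (Hn k). cbv beta in T. assert (H := Cmod_ge_0 (c k)).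
    assert (Hsq := Rle_trans _ _ _ T Hn). nra. }
  destruct (Rlt_le_dec (Cmod (c 1%nat)) 1) as [H1|H1].
  { now apply substitution_bounded. }
  assert (E1 : Cmod (c 1%nat) = 1) by (apply Rle_antisym; auto).
  assert (Hrot : forall k, k <> 1%nat -> c k = 0).
  { intros k Hk. destruct k as [|[|k]]; [exact Hc0|lia|].
    apply Cmod_eq_0. specialize (Hn (S (S k))).
    rewrite rsum_shift, rsum_shift in Hn.
    assert (T := rsum_term (fun k => Cmod (c (S (S k))) ^ 2) k k (fun k => pow2_ge_0 _) (Nat.le_refl k)).
    cbv beta in T. rewrite E1 in Hn. assert (H0 := pow2_ge_0 (Cmod (c 0%nat))).
    assert (H := Cmod_ge_0 (c (S (S k)))). nra. }
  exists 1. split; [lra|]. intros a N. rewrite Rmult_1_l. right. apply sum_n_ext_loc. intros m Hm.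
  f_equal. f_equal. unfold subst_coef.
  transitivity (Cmod (a m * c 1%nat ^ m)).
  - f_equal. transitivity (sum_n (fun n => if Nat.eqb n m then (a n * c 1%nat ^ n)%C else RtoC 0) N).
    + apply sum_n_ext. intros n. rewrite rotation_coef by assumption.
      destruct (Nat.eqb n m); cring.
    + now apply (csum_delta (fun n => (a n * c 1%nat ^ n)%C)).
  - rewrite Cmod_mult, Cmod_pow, E1, pow1. ring.
Qed.

(** * From partial sums to series *)

Lemma bounded_partial_sums (u : nat -> R) L : (forall n, 0 <= u n) ->
  (forall N, sum_n u N <= L) -> ex_series u.
Proof.
  intros H0 HL.
  assert (E : ex_finite_lim_seq (sum_n u)).
  { apply (ex_finite_lim_seq_incr _ L); [|exact HL].
    intros n. rewrite rsum_S. specialize (H0 (S n)). lra. }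
  destruct E as [l Hl]. exists l. exact Hl.
Qed.

Lemma is_series_partial_le (u : nat -> R) l : (forall n, 0 <= u n) -> is_series u l ->
  forall N, sum_n u N <= l.
Proof.
  intros H0 Hl N.
  apply (is_lim_seq_incr_compare (sum_n u) l Hl).
  intros n. rewrite rsum_S. specialize (H0 (S n)). lra.
Qed.

Lemma is_series_le_bound (u : nat -> R) l L : is_series u l ->
  (forall N, sum_n u N <= L) -> l <= L.
Proof.
  intros Hl HL.
  exact (is_lim_seq_le (sum_n u) (fun _ => L) l L HL Hl (is_lim_seq_const L)).
Qed.

(** Both sequences are jets of order [N] of the same function at the origin. *)
Lemma composition_coef f phi (a c b : nat -> C) : power_series_on_disk a f -> power_series_on_disk c phi ->
  c 0%nat = 0 -> power_series_on_disk b (fun z => f (phi z)) ->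
  forall N m, (m <= N)%nat -> b m = subst_coef c a N m.
Proof.
  intros Ha Hc Hc0 Hb N m Hm.
  assert (Hj : forall g d, power_series_on_disk d g -> jet N g d).
  { intros g d Hd. apply (pseries_jet N g d (1 / 2)); [lra|].
    intros z Hz. apply Hd. unfold in_disk. lra. }
  apply (jet_unique N (fun z => f (phi z)) b (subst_coef c a N)); [now apply Hj| |exact Hm].
  apply jet_comp; auto.
Qed.

Theorem theorem3p3 :
  forall beta : nat -> R,
    positive_seq beta ->
    polynomial_decay beta ->
    polynomial_growth beta ->
    weakly_decreasing beta ->
    forall phi : C -> C,
      is_symbol phi ->
      phi (RtoC 0) = RtoC 0 ->
      bounded_on_H2 beta (composition_operator phi).
Proof.
  intros beta Hpos Hdec _ Hwd phi (Hphi & Hself & _) H0.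
  destruct (taylor_disk phi (analytic_cderiv phi Hphi)) as [c Hc].
  assert (Hc0 : c 0%nat = 0).
  { rewrite <- H0. apply eq_of_close. intros eps He.
    destruct (proj1 (is_pseries_eps c 0 (phi 0)) (Hc 0 ltac:(unfold in_disk; rewrite Cmod_0; lra)) eps He)
      as [N HN].
    specialize (HN N (Nat.le_refl N)). rewrite cpoly_0 in HN. now left. }
  destruct (substitution_bounded_self_map beta c Hpos Hdec Hwd Hc0
    (multiplier_contraction phi c Hself Hc)) as (K & HK & HKb).
  (* Any expansion [b] of the composite is allowed: stability of the space uses the one from
     [taylor_disk], the norm inequality the one given with the norm. *)
  assert (Hcoef : forall f a b, power_series_on_disk a f ->
    power_series_on_disk b (composition_operator phi f) ->
    forall N, sum_n (fun m => Cmod (b m) ^ 2 * beta m) N <=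
      K * sum_n (fun n => Cmod (a n) ^ 2 * beta n) N).
  { intros f a b Ha Hb N.
    assert (Hco := composition_coef f phi a c b Ha Hc Hc0 Hb N).
    rewrite (sum_n_ext_loc _ (fun m => beta m * Cmod (subst_coef c a N m) ^ 2)).
    - rewrite (sum_n_ext (fun n => Cmod (a n) ^ 2 * beta n) (fun n => beta n * Cmod (a n) ^ 2));
        [apply HKb|]. intros n. apply Rmult_comm.
    - intros m Hm. rewrite <- Hco by assumption. apply Rmult_comm. }
  assert (Hterm : forall (a : nat -> C) n, 0 <= Cmod (a n) ^ 2 * beta n).
  { intros a n. apply Rmult_le_pos; [apply pow2_ge_0|left; apply Hpos]. }
  split.
  - intros f [Hf (a & Ha & l & Hl)].
    assert (Hcomp : forall z, Cmod z < 1 -> exists k, cderiv (composition_operator phi f) z k).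
    { intros z Hz.
      destruct (analytic_cderiv phi Hphi z Hz) as [k Hk].
      destruct (analytic_cderiv f Hf (phi z) (Hself z Hz)) as [k' Hk'].
      exists (k * k')%C. now apply (cderiv_comp f phi). }
    split.
    + intros z Hz. destruct (Hcomp z Hz) as [k Hk]. exists k. now apply cderiv_is_derive.
    + destruct (taylor_disk _ Hcomp) as [b Hb]. exists b. split; [exact Hb|].
      apply (bounded_partial_sums _ (K * l)); [apply Hterm|]. intros N.
      eapply Rle_trans; [apply (Hcoef f a b Ha Hb)|]. apply Rmult_le_compat_l; [exact HK|].
      apply is_series_partial_le; [apply Hterm|exact Hl].
  (* [K] bounds squared norms, hence the square root. *)
  - exists (sqrt K). intros f N N' _ (HN & a & Ha & Hsa) (HN' & b & Hb & Hsb).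
    rewrite <- (sqrt_pow2 N) by exact HN. rewrite <- (sqrt_pow2 N') by exact HN'.
    rewrite <- sqrt_mult; [|exact HK|apply pow2_ge_0]. apply sqrt_le_1_alt.
    apply (is_series_le_bound _ _ _ Hsb). intros n.
    eapply Rle_trans; [apply (Hcoef f a b Ha Hb)|]. apply Rmult_le_compat_l; [exact HK|].
    apply is_series_partial_le; [apply Hterm|exact Hsa].
Qed.
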